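(* Assume that $0$ belongs to the spectrum of $A$. Then $$\limsup_{t\to\infty}\ \sup_{\|(u_0,u_1)\|_{\mathcal H}\leq 1} t\,\| u(t)-B^{-1/2}e^{-t\tilde A}B^{1/2}u_0-B^{-1/2}e^{-t\tilde A}B^{-1/2}u_1\|_H>0,$$ where $u(t)$ is the solution of $(\partial_t^2+A+B\partial_t)u=0$, $u|_{t=0}=u_0$, $\partial_tu|_{t=0}=u_1$.
   Context: $H$ is a Hilbert space. $A$ is a densely defined self-adjoint operator on $H$ that is positive, $A>0$ (i.e. $(Au,u)_H>0$ for $0\neq u\in D(A)$). $B$ is a bounded self-adjoint operator on $H$ with $B\geq c\,\mathrm{Id}$ for some constant $c>0$. The operators $B^{1/2}$ and $B^{-1/2}$ are continuous on $D(A)$: they map $D(A)$ into $D(A)$ and there is a constant $C>0$ such that $\|AB^{1/2}u\|_H\le C(\|u\|_H+\|Au\|_H)$ and $\|AB^{-1/2}u\|_H\le C(\|u\|_H+\|Au\|_H)$ for all $u\in D(A)$. Put $\tilde A=B^{-1/2}AB^{-1/2}$, which is self-adjoint with domain $D(A)$; $e^{-t\tilde A}$ is defined by the spectral theorem. Let $H_1$ be the Hilbert space completion of $D(A)$ for the norm $\|u\|_{H_1}=\|\sqrt A u\|_H$ (so $D(\sqrt A)$ embeds in $H_1$, and $A$ extends to a bounded operator from $H_1$ to its dual), and $\mathcal H_0=H_1\times H$. Let $\mathcal H=D(\sqrt A)\times H$ with norm $\|(u,v)\|_{\mathcal H}=(\|u\|_H^2+\|u\|_{H_1}^2+\|v\|_H^2)^{1/2}$.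 The operator $\mathcal A(u,v)=(v,-Au-Bv)$ on $\mathcal H_0$ with domain $\{(u,v)\in H_1\times H: Au\in H,\ v\in D(\sqrt A)\}$ generates a contraction semigroup $U(t)=e^{t\mathcal A}$ on $\mathcal H_0$, which maps $\mathcal H$ into itself. For $(u_0,u_1)\in\mathcal H$ the solution $u(t)\in D(\sqrt A)$ is the first component of $U(t)(u_0,u_1)$. *)

(* Defs.v *)
From HB Require Import structures.
From mathcomp Require Import all_boot all_order all_algebra.
From mathcomp Require Import all_classical all_reals all_analysis.
From mathcomp Require Import complex.

Set Implicit Arguments.
Unset Strict Implicit.
Unset Printing Implicit Defensive.

Import Order.TTheory GRing.Theory Num.Theory.
Import numFieldNormedType.Exports.

Local Open Scope classical_set_scope.
Local Open Scope ring_scope.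
Local Open Scope complex_scope.

(* Hilbert spaces are complex; the inner product is linear in its first
   argument and conjugate-linear in the second. *)
Record hilbertSpace (R : realType) := HilbertSpace {
  hilbert_carrier :> completeNormedModType R[i];
  inner : {dot hilbert_carrier for (@Num.conj R[i])};
  inner_norm : forall u, inner u u = `|u| ^+ 2 }.

(* The library norm takes values in R[i]; [hnorm] is its real value. *)
Definition hnorm (R : realType) (H : normedModType R[i]) (u : H) : R :=
  complex.Re `|u|.

(* A partially defined operator: the values of [app] outside [dom] are
   irrelevant. *)
Record operator (T : Type) := Operator { dom : set T; app :> T -> T }.

Definition everywhere (T : Type) (f : T -> T) : operator T := Operator setT f.

Section operators.
Variables (R : realType) (H : hilbertSpace R).
Implicit Types (T S : operator H) (f : H -> H) (u v w : H).

Definition linear_operator T : Prop :=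
  dom T 0 /\
  forall (a : R[i]) u v, dom T u -> dom T v ->
    dom T (a *: u + v) /\ T (a *: u + v) = a *: T u + T v.

(* T is densely defined and the graph of the adjoint of T is the graph of T. *)
Definition self_adjoint T : Prop :=
  [/\ linear_operator T, dense (dom T) &
      forall v w,
        (forall u, dom T u -> inner H (T u) v = inner H u w) <->
        (dom T v /\ T v = w)].

Definition positive_operator T : Prop :=
  forall u, dom T u -> u != 0 -> 0 < inner H (T u) u.

Definition nonneg_operator T : Prop :=
  forall u, dom T u -> 0 <= inner H (T u) u.

Definition bounded_operator f : Prop :=
  exists M : R, forall u, hnorm (f u) <= M * hnorm u.

Definition resolvent_set T : set R[i] := [set z |
  exists2 S : {linear H -> H}, bounded_operator S &
    (forall v, dom T (S v) /\ T (S v) - z *: S v = v) /\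
    (forall u, dom T u -> S (T u - z *: u) = u)].

Definition spectrum T : set R[i] := ~` resolvent_set T.

(* S is the nonnegative self-adjoint square root of T; the domain of S \o S
   is the domain of T. *)
Definition is_sqrt T S : Prop :=
  [/\ self_adjoint S, nonneg_operator S,
      forall u, dom T u <-> dom S u /\ dom S (S u) &
      forall u, dom T u -> T u = S (S u)].

End operators.

(* A resolution of the identity of H on the Borel sets of the real line;
   [smeasure u] is the scalar measure X |-> (E(X) u, u). *)
Record resolution_of_identity (R : realType) (H : hilbertSpace R) :=
  ResolutionOfIdentity {
    sproj : set (measurableTypeR R) -> {linear H -> H};
    smeasure : H -> {measure set (measurableTypeR R) -> \bar R};
    sproj_sym : forall X, measurable X -> forall u v,
      inner H (sproj X u) v = inner H u (sproj X v);
    sprojT : forall u, sproj setT u = u;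
    sprojI : forall X Y, measurable X -> measurable Y -> forall u,
      sproj (X `&` Y) u = sproj X (sproj Y u);
    smeasureE : forall u X, measurable X ->
      smeasure u X = (complex.Re (inner H (sproj X u) u))%:E }.

(* T is the integral of the real Borel function f with respect to E. The
   quadratic form of a densely defined linear operator on a complex space
   determines the operator, so the diagonal identity suffices. *)
Definition is_spectral_integral (R : realType) (H : hilbertSpace R)
    (E : resolution_of_identity H) (f : R -> R) (T : operator H) : Prop :=
  [/\ linear_operator T,
      forall u, dom T u <->
        (\int[smeasure E u]_(x in setT) ((f x) ^+ 2)%:E < +oo)%E &
      forall u, dom T u ->
        inner H (T u) u = (\int[smeasure E u]_(x in setT) f x)%:C].

(* The operators exp(- t T), t >= 0, given by the spectral theorem. *)
Definition is_exp_semigroup (R : realType) (H : hilbertSpace R)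
    (T : operator H) (V : R -> {linear H -> H}) : Prop :=
  exists2 E : resolution_of_identity H, is_spectral_integral E id T &
    forall t : R, 0 <= t ->
      is_spectral_integral E (fun x => expR (- (t * x))) (everywhere (V t)).

Section damped_wave.
Variables (R : realType) (H H1 : hilbertSpace R).
Variables (A sqrtA : operator H) (B : {linear H -> H}).

(* (H1, iota) is the completion of D(A) for the norm u |-> |sqrt(A) u|; iota is
   the resulting embedding of D(sqrt A) into H1. Its values outside D(sqrt A)
   are irrelevant. *)
Definition is_energy_completion (iota : H -> H1) : Prop :=
  [/\ forall (a : R[i]) u v, dom sqrtA u -> dom sqrtA v ->
        iota (a *: u + v) = a *: iota u + iota v,
      forall u, dom sqrtA u -> hnorm (iota u) = hnorm (sqrtA u) &
      dense (iota @` dom A)].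

Variable iota : H -> H1.

(* A u = w for u in H1 and w in H. For u, v in D(A) one has
   (A u, v)_H = (iota u, iota v)_H1, so the extension of A to H1 sends u to the
   functional (u, .)_H1. *)
Definition extends_to (u : H1) (w : H) : Prop :=
  forall v, dom sqrtA v -> inner H1 u (iota v) = inner H w v.

(* The graph of (u, v) |-> (v, - A u - B v), with domain
   {(u, v) | A u \in H, v \in D(sqrt A)}. *)
Definition wave_generator (x y : (H1 * H)%type) : Prop :=
  [/\ dom sqrtA x.2, y.1 = iota x.2 &
      exists2 w, extends_to x.1 w & y.2 = - w - B x.2].

Definition norm0 (x : (H1 * H)%type) : R :=
  Num.sqrt (hnorm x.1 ^+ 2 + hnorm x.2 ^+ 2).

Definition energy_norm (u v : H) : R :=
  Num.sqrt (hnorm u ^+ 2 + hnorm (iota u) ^+ 2 + hnorm v ^+ 2).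

Definition contraction_semigroup (U : R -> {linear (H1 * H)%type -> (H1 * H)%type})
    : Prop :=
  [/\ forall x, U 0 x = x,
      forall s t, 0 <= s -> 0 <= t -> forall x, U (s + t) x = U s (U t x),
      forall x, U t x @[t --> 0^'+] --> x &
      forall t, 0 <= t -> forall x, norm0 (U t x) <= norm0 x].

Definition is_generator (G : (H1 * H)%type -> (H1 * H)%type -> Prop)
    (U : R -> {linear (H1 * H)%type -> (H1 * H)%type}) : Prop :=
  forall x y, G x y <->
    ((h^-1)%:C *: (U h x - x)) @[h --> 0^'+] --> y.

(* u t u0 u1 is the solution at time t with data (u0, u1): the element of
   D(sqrt A) which iota sends to the first component of U(t)(u0, u1). *)
Definition is_wave_solution (U : R -> {linear (H1 * H)%type -> (H1 * H)%type})
    (u : R -> H -> H -> H) : Prop :=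
  forall t, 0 <= t -> forall u0 u1, dom sqrtA u0 ->
    dom sqrtA (u t u0 u1) /\ iota (u t u0 u1) = (U t (iota u0, u1)).1.

End damped_wave.

(* Main.v *)
Require Import Defs.
From HB Require Import structures.
From mathcomp Require Import all_boot all_order all_algebra.
From mathcomp Require Import all_classical all_reals all_analysis.
From mathcomp Require Import measurable_realfun complex ring lra.

(** Take u1 = - B u0, for which the diffusive approximation vanishes: one must
show that u(t) itself is not o(1/t) uniformly in the data. Since 0 lies in the
spectrum of A, the operator At = B^{-1/2} A B^{-1/2} is not coercive while being
positive, so its spectral projection on ]1/(k+1), 1/k] is nonzero for infinitely
many k. With mu = 1/k this gives f with |At f - mu f| <= mu^2 |f|; put
psi = B^{-1/2} f, so that A psi is mu B psi up to O(mu^2), and u0 = psi.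
Pairing the equation with chi(t) psi on [0, 1/mu], where
chi(t) = (1 - mu t)^2 (1 + 3 mu t), leaves the boundary term - mu |psi|^2 and a
remainder whose integrand is O(mu^2 (1 + t) |u(t)|), because chi' = mu chi at 0.
If |u(t)| <= delta / t for t >= t0, the remainder is O(mu^2 C(t0)) + O(delta mu),
which contradicts the size of the boundary term when delta and then mu are small.
The energy space only controls sqrt(A) u, so t |-> u(t) is first differentiated
in H against the range of A, which is dense because A is injective and self-adjoint. *)

Set Implicit Arguments.
Unset Strict Implicit.
Unset Printing Implicit Defensive.

Import Order.TTheory GRing.Theory Num.Theory.
Import numFieldNormedType.Exports.

Local Open Scope classical_set_scope.
Local Open Scope ring_scope.
Local Open Scope complex_scope.

(** * Norms and real inner products *)

(** Real parts keep every estimate in the ordered field [R]; the complex product is recovered from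
    [rip] by also testing on [i u]. *)
Definition rip (R : realType) (H : hilbertSpace R) (u v : H) : R :=
  complex.Re (inner H u v).

Section real_norm.
Variables (R : realType) (V : normedModType R[i]).
Implicit Types u v : V.

Lemma normr_hnorm u : `|u| = (hnorm u)%:C.
Proof. by rewrite /hnorm RRe_real // normr_real. Qed.

Lemma hnorm_ge0 u : 0 <= hnorm u.
Proof. by have := normr_ge0 u; rewrite normr_hnorm lecR. Qed.

Lemma hnorm0 : hnorm (0 : V) = 0.
Proof. by rewrite /hnorm normr0. Qed.

Lemma hnorm_eq0 u : hnorm u = 0 -> u = 0.
Proof. by move=> h; apply/normr0_eq0; rewrite normr_hnorm h. Qed.

Lemma hnorm_opp u : hnorm (- u) = hnorm u.
Proof. by rewrite /hnorm normrN. Qed.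

Lemma hnorm_distC u v : hnorm (u - v) = hnorm (v - u).
Proof. by rewrite -hnorm_opp opprB. Qed.

Lemma hnorm_triangle u v : hnorm (u + v) <= hnorm u + hnorm v.
Proof. by have := ler_normD u v; rewrite !normr_hnorm -rmorphD lecR. Qed.

Lemma hnorm_scale (a : R) u : hnorm (a%:C *: u) = `|a| * hnorm u.
Proof.
rewrite /hnorm normrZ normr_hnorm.
have -> : `|a%:C| = `|a|%:C :> R[i] by rewrite normc_def /= expr0n addr0 sqrtr_sqr.
by rewrite -rmorphM.
Qed.

(** A positive element of [R[i]] is real, so complex radii reduce to real ones. *)
Lemma cvg_hnormP {T : Type} {F : set_system T} {FF : Filter F} (f : T -> V) v :
  f @ F --> v <-> forall e : R, 0 < e -> \forall x \near F, hnorm (v - f x) < e.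
Proof.
split=> [/cvgrPdist_lt h e e0|h].
  have := h e%:C; rewrite ltcR => /(_ e0); apply: filterS => x.
  by rewrite normr_hnorm ltcR.
apply/cvgrPdist_lt => -[e i]; rewrite ltcE /= => /andP[/eqP -> e0].
have := h _ e0; apply: filterS => x.
by rewrite normr_hnorm -[X in _ -> _ < X]/(e%:C) ltcR.
Qed.

End real_norm.

Section real_inner_product.
Variables (R : realType) (H : hilbertSpace R).
Implicit Types u v w : H.

Lemma ripC u v : rip u v = rip v u.
Proof.
have reconj (z : R[i]) : complex.Re (Num.conj z) = complex.Re z by case: z.
by rewrite /rip hermC expr0 mul1r; exact: reconj.
Qed.

Lemma ripDl u v w : rip (u + v) w = rip u w + rip v w.
Proof. by rewrite /rip linearDl raddfD. Qed.

Lemma ripDr u v w : rip w (u + v) = rip w u + rip w v.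
Proof. by rewrite !(ripC w) ripDl. Qed.

Lemma ripZl (a : R) u v : rip (a%:C *: u) v = a * rip u v.
Proof.
rewrite /rip linearZl_LR.
have reM (z : R[i]) : complex.Re (a%:C * z) = a * complex.Re z.
  by case: z => x y /=; rewrite mul0r subr0.
exact: reM.
Qed.

Lemma ripZr (a : R) u v : rip u (a%:C *: v) = a * rip u v.
Proof. by rewrite !(ripC u) ripZl. Qed.

Lemma ripNl u v : rip (- u) v = - rip u v.
Proof. by rewrite /rip linearNl raddfN. Qed.

Lemma ripNr u v : rip v (- u) = - rip v u.
Proof. by rewrite !(ripC v) ripNl. Qed.

Lemma rip0l u : rip 0 u = 0.
Proof. by rewrite /rip linear0l. Qed.

Lemma rip0r u : rip u 0 = 0.
Proof. by rewrite ripC rip0l. Qed.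

Definition ripE := (ripDl, ripDr, ripNl, ripNr, ripZl, ripZr).

Lemma inner_rip u v : inner H u v = (rip u v)%:C + 'i%C * (- rip ('i%C *: u) v)%:C.
Proof.
rewrite /rip linearZl_LR.
have decomp (z : R[i]) :
    z = (complex.Re z)%:C + 'i%C * (- complex.Re ('i%C * z))%:C.
  by case: z => x y; simpc; congr (_ +i* _); lra.
exact: decomp.
Qed.

Lemma ripuu u : rip u u = hnorm u ^+ 2.
Proof. by rewrite /rip inner_norm normr_hnorm -rmorphXn. Qed.

Lemma rip_ge0 u : 0 <= rip u u.
Proof. by rewrite ripuu sqr_ge0. Qed.

Lemma rip_eq0 u : rip u u = 0 -> u = 0.
Proof. by rewrite ripuu => /eqP; rewrite sqrf_eq0 => /eqP /hnorm_eq0. Qed.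

(** Cauchy-Schwarz, from the nonnegative square norm of [|z| w - |w| z]; the other sign comes from
    replacing [u] by [- u]. *)
Lemma rip_le u v : `|rip u v| <= hnorm u * hnorm v.
Proof.
suff h w z : rip w z <= hnorm w * hnorm z.
  by rewrite ler_norml h -lerNl -ripNl -[hnorm u]hnorm_opp h.
have [/hnorm_eq0 ->|w0] := eqVneq (hnorm w) 0; first by rewrite rip0l hnorm0 mul0r.
have [/hnorm_eq0 ->|z0] := eqVneq (hnorm z) 0; first by rewrite rip0r hnorm0 mulr0.
have w1 : 0 < hnorm w by rewrite lt0r w0 hnorm_ge0.
have z1 : 0 < hnorm z by rewrite lt0r z0 hnorm_ge0.
have := rip_ge0 ((hnorm z)%:C *: w - (hnorm w)%:C *: z).
rewrite !ripE (ripC z w) !ripuu => h.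
rewrite -(ler_pM2l (mulr_gt0 w1 z1)).
by move: (rip w z) h => r; nra.
Qed.

(** Lets a bound on the functional [rip _ v] be checked only on vectors of a dense set, such as a
    domain or a range. *)
Lemma rip_le_approx u v (a : R) : 0 <= a ->
  (forall e, 0 < e -> exists2 w, hnorm (u - w) < e & rip w v <= a * hnorm w) ->
  rip u v <= a * hnorm u.
Proof.
move=> a0 h; rewrite leNgt; apply/negP => hlt.
(* With this [e], the total error [e * (a + |v|)] stays strictly below the gap [rip u v - a |u|]. *)
pose e := (rip u v - a * hnorm u) / (a + hnorm v + 1).
have d0 : 0 < a + hnorm v + 1 by have := hnorm_ge0 v; lra.
have e0 : 0 < e by rewrite divr_gt0 // subr_gt0.
have [w uw wv] := h e e0.
have h1 : rip u v <= rip w v + e * hnorm v.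
  have -> : rip u v = rip w v + rip (u - w) v by rewrite !ripE; lra.
  rewrite lerD2l (le_trans (ler_norm _)) // (le_trans (rip_le _ _)) //.
  by rewrite ler_wpM2r ?hnorm_ge0 // ltW.
have h2 : hnorm w <= hnorm u + e.
  have -> : w = u + - (u - w) by rewrite opprB addrCA subrr addr0.
  by rewrite (le_trans (hnorm_triangle _ _)) // hnorm_opp lerD2l ltW.
have h3 : a * hnorm w <= a * hnorm u + a * e by rewrite -mulrDr ler_wpM2l.
have : e * (a + hnorm v + 1) = rip u v - a * hnorm u by rewrite divfK // gt_eqF.
nra.
Qed.

End real_inner_product.

Lemma rip_inner_eq (R : realType) (H H' : hilbertSpace R) (u v : H) (u' v' : H') :
  rip u v = rip u' v' -> rip ('i%C *: u) v = rip ('i%C *: u') v' ->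
  inner H u v = inner H' u' v'.
Proof. by move=> h h'; rewrite [LHS]inner_rip [RHS]inner_rip h h'. Qed.

(** * Density and self-adjoint operators *)

Lemma inv_succ_lt (R : realType) (e : R) : 0 < e ->
  exists N : nat, forall n, (N <= n)%N -> n.+1%:R^-1 < e.
Proof.
move=> e0; exists (Num.truncn e^-1) => n Nn.
rewrite invf_plt ?posrE ?ltr0n //.
rewrite (lt_le_trans (truncnS_gt _)) // ler_nat; exact: Nn.
Qed.

Section density.
Variables (R : realType) (H : hilbertSpace R).
Implicit Types u v w : H.

Lemma hnorm_cauchy (x : nat -> H) :
  (forall e : R, 0 < e -> exists N, forall n, (N <= n)%N -> hnorm (x N - x n) < e) ->
  exists l, forall e : R, 0 < e ->
    exists N, forall n, (N <= n)%N -> hnorm (l - x n) < e.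
Proof.
move=> h; have : cvg (x @ \oo).
  apply/cauchy_cvgP/cauchy_exP => -[e i]; rewrite ltcE /= => /andP[/eqP -> e0].
  have [N hN] := h _ e0; exists (x N); exists N => // n /hN.
  by rewrite -ball_normE /= normr_hnorm -[X in _ -> _ < X]/(e%:C) ltcR.
move=> /cvg_ex[l /cvg_hnormP hl]; exists l => e /hl[N _ hN]; by exists N.
Qed.

Lemma dense_hnorm (S : set H) : dense S ->
  forall x (e : R), 0 < e -> exists2 y, S y & hnorm (x - y) < e.
Proof.
move=> dS x e e0.
have xi : ((ball x e%:C)^°)%classic x.
  by apply: nbhsx_ballx; rewrite ltcR.
have [y [/interior_subset + Sy]] := dS _ (ex_intro _ x xi) (open_interior _).
by rewrite -ball_normE /= normr_hnorm ltcR; exists y.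
Qed.

(* A minimising sequence of the distance from x to M is Cauchy by the
   parallelogram law, and its limit p satisfies x - p \perp M. *)
Lemma dense_of_orthogonal (M : set H) : M 0 ->
  (forall (a : R[i]) u v, M u -> M v -> M (a *: u + v)) ->
  (forall x, (forall m, M m -> rip m x = 0) -> x = 0) ->
  forall x (e : R), 0 < e -> exists2 m, M m & hnorm (x - m) < e.
Proof.
move=> M0 Mlin Morth x e e0.
pose D : set R := [set hnorm (x - m) ^+ 2 | m in M].
have lbD : has_lbound D by exists 0 => _ [m _ <-]; exact: sqr_ge0.
have D0 : has_inf D by split => //; exists (hnorm (x - 0) ^+ 2), 0.
pose d := inf D.
have dle m : M m -> d <= hnorm (x - m) ^+ 2 by move=> Mm; apply: ge_inf => //; exists m.
have hn n : exists m, M m /\ hnorm (x - m) ^+ 2 < d + n.+1%:R^-1.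
  have [|_ [m Mm <-] ?] := inf_adherent (_ : 0 < n.+1%:R^-1) D0.
    by rewrite invr_gt0 ltr0n.
  by exists m.
have [m hm] := choice hn.
have Mm n : M (m n) by case: (hm n).
have mm n k : hnorm (m n - m k) ^+ 2 <= 2 * (n.+1%:R^-1 + k.+1%:R^-1).
  have hh : M ((2^-1)%:C *: (m n + m k)).
    rewrite -[_ *: _]addr0; apply: (Mlin) => //.
    by rewrite -[m n]scale1r; apply: Mlin.
  have := dle _ hh; have [_] := hm n; have [_] := hm k.
  rewrite -!ripuu !ripE (ripC (m n) x) (ripC (m k) x) (ripC (m k) (m n)).
  move: (n.+1%:R^-1) (k.+1%:R^-1) => *; lra.
have [p hp] : exists l, forall e : R, 0 < e ->
    exists N, forall n, (N <= n)%N -> hnorm (l - m n) < e.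
  apply: hnorm_cauchy => r r0.
  have r20 : 0 < r ^+ 2 / 4 by rewrite divr_gt0 // exprn_gt0.
  have [N hN] := inv_succ_lt r20; exists N => n Nn.
  rewrite -(ltr_pXn2r (ltn0Sn 1)) ?nnegrE ?hnorm_ge0 ?(ltW r0) //.
  apply: le_lt_trans (mm N n) _.
  have := hN n Nn; have := hN N (leqnn N).
  by move: (n.+1%:R^-1) (N.+1%:R^-1) => *; lra.
suff -> : x = p.
  by have [N hN] := hp e e0; exists (m N) => //; apply: hN.
apply/eqP; rewrite -subr_eq0; apply/eqP; apply: Morth => k Mk.
(* Moving [m n] to [m n + s k] cannot bring the squared distance below [d]; letting [n] grow gives
   this quadratic inequality in [s]. *)
have main (s : R) : 2 * s * rip k (x - p) <= s ^+ 2 * hnorm k ^+ 2.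
  rewrite leNgt; apply/negP => hlt.
  pose del := 2 * s * rip k (x - p) - s ^+ 2 * hnorm k ^+ 2.
  have del0 : 0 < del by rewrite subr_gt0.
  pose c := 2 * `|s| * hnorm k + 1.
  have c0 : 0 < c by rewrite ltr_wpDl // !mulr_ge0 // hnorm_ge0.
  have [N1 hN1] := inv_succ_lt (divr_gt0 del0 (ltr0Sn R 1)).
  have [N2 hN2] := hp (del / 2 / c) (divr_gt0 (divr_gt0 del0 (ltr0Sn R 1)) c0).
  pose n := maxn N1 N2.
  have h1 := hN1 n (leq_maxl _ _); have h2 := hN2 n (leq_maxr _ _).
  have hk : M (s%:C *: k + m n) by apply: Mlin.
  have h3 := dle _ hk; have [_ h4] := hm n.
  have h5 : 2 * s * rip k (p - m n) >= - (del / 2).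
    rewrite lerNl (le_trans (ler_norm _)) // normrN normrM (normrM 2) (@ger0_norm _ 2) //.
    have s0 : 0 <= 2 * `|s| by rewrite mulr_ge0.
    rewrite (le_trans (ler_wpM2l s0 (rip_le _ _))) //.
    have : c * hnorm (p - m n) <= del / 2.
      by rewrite mulrC -ler_pdivlMr // ltW.
    have := hnorm_ge0 (p - m n); rewrite /c; move: (hnorm (p - m n)) => z.
    by nra.
  move: h3 h4 h5 h1; rewrite /del -!ripuu !ripE.
  rewrite (ripC (m n) x) (ripC k x) (ripC k (m n)) (ripC (m n) k) (ripC k p).
  by move: (n.+1%:R^-1) => *; lra.
have [->|k0] := eqVneq k 0; first by rewrite rip0l.
have kk : 0 < hnorm k ^+ 2.
  by rewrite exprn_gt0 // lt0r hnorm_ge0 andbT; apply: contra_neq k0 => /hnorm_eq0.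
(* At this [s] the inequality reads [2 r^2 / q <= r^2 / q], which forces [r = 0]. *)
have := main (rip k (x - p) / hnorm k ^+ 2).
set r := rip k _; set q := hnorm k ^+ 2.
have -> : (r / q) ^+ 2 * q = r ^+ 2 / q by field; rewrite gt_eqF.
have -> : 2 * (r / q) * r = 2 * (r ^+ 2 / q) by ring.
have : 0 <= r ^+ 2 / q by rewrite divr_ge0 ?sqr_ge0 // ltW.
move=> h1 h2; have /eqP : r ^+ 2 / q = 0 by lra.
by rewrite mulf_eq0 invr_eq0 (gt_eqF kk) orbF sqrf_eq0 => /eqP.
Qed.

End density.

Section linear_operators.
Variables (R : realType) (H : hilbertSpace R).
Variables (T : operator H) (hT : linear_operator T).
Implicit Types u v : H.

Lemma lop_dom0 : dom T 0.
Proof. by case: hT. Qed.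

Lemma lop_lin (a : R[i]) u v : dom T u -> dom T v ->
  dom T (a *: u + v) /\ T (a *: u + v) = a *: T u + T v.
Proof. by case: hT => _; apply. Qed.

Lemma lop0 : T 0 = 0.
Proof.
have [_] := lop_lin (- 1) lop_dom0 lop_dom0.
by rewrite scaler0 addr0 scaleN1r addNr.
Qed.

Lemma lopZ (a : R[i]) u : dom T u -> dom T (a *: u) /\ T (a *: u) = a *: T u.
Proof. by move=> Tu; have := lop_lin a Tu lop_dom0; rewrite lop0 !addr0. Qed.

Lemma lopD u v : dom T u -> dom T v -> dom T (u + v) /\ T (u + v) = T u + T v.
Proof. by move=> Tu Tv; have := lop_lin 1 Tu Tv; rewrite !scale1r. Qed.

Lemma lopB u v : dom T u -> dom T v -> dom T (u - v) /\ T (u - v) = T u - T v.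
Proof.
by move=> Tu Tv; have := lop_lin (- 1) Tv Tu; rewrite !scaleN1r ![- _ + _]addrC.
Qed.

End linear_operators.

Section self_adjoint_operators.
Variables (R : realType) (H : hilbertSpace R).
Variables (T : operator H) (hT : self_adjoint T).
Implicit Types u v w : H.

Lemma sa_lop : linear_operator T.
Proof. by case: hT. Qed.

Lemma sa_sym u v : dom T u -> dom T v -> rip (T u) v = rip u (T v).
Proof.
by case: hT => _ _ h Tu Tv; rewrite /rip; have [_ /(_ (conj Tv erefl))->] := h v (T v).
Qed.

(** Testing on [i u] as well as [u] restores the complex pairing, so real pairings suffice to
    identify the adjoint. *)
Lemma sa_adjointP v w : (forall u, dom T u -> rip (T u) v = rip u w) ->
  dom T v /\ T v = w.
Proof.
move=> h; case: (hT) => _ _ /(_ v w)[+ _]; apply => u Tu.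
have [Tiu eiu] := lopZ sa_lop 'i Tu.
by apply: rip_inner_eq; rewrite -?eiu h.
Qed.

(** A vector orthogonal to the range lies in the kernel of the adjoint, which is [T] itself. *)
Lemma sa_range_dense : (forall u, dom T u -> T u = 0 -> u = 0) ->
  forall x (e : R), 0 < e -> exists2 u, dom T u & hnorm (x - T u) < e.
Proof.
move=> Tinj x e e0.
have [|||_ [u Tu <-] ?] := @dense_of_orthogonal R H (T @` dom T) _ _ _ x e e0.
- by exists 0; [exact: (lop_dom0 sa_lop)|exact: (lop0 sa_lop)].
- move=> a _ _ [u Tu <-] [v Tv <-]; have [? <-] := lop_lin sa_lop a Tu Tv.
  by exists (a *: u + v).
- move=> y hy; have [|Ty Ty0] := @sa_adjointP y 0; last exact: Tinj.
  by move=> u Tu; rewrite rip0r; apply: hy; exists u.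
- by exists u.
Qed.

(** Coercivity gives [a |u| <= |T u|], hence injectivity and a bounded inverse on the range. The
    range is dense, and preimages of a convergent sequence are Cauchy, so it is all of [H]. Used in
    contrapositive form: 0 in the spectrum rules out coercivity. *)
Lemma sa_coercive_resolvent (a : R) : 0 < a ->
  (forall u, dom T u -> a * hnorm u ^+ 2 <= rip (T u) u) -> resolvent_set T 0.
Proof.
move=> a0 coer.
have low u : dom T u -> a * hnorm u <= hnorm (T u).
  move=> Tu; have [/hnorm_eq0 ->|u0] := eqVneq (hnorm u) 0.
    by rewrite hnorm0 mulr0 hnorm_ge0.
  have u1 : 0 < hnorm u by rewrite lt0r u0 hnorm_ge0.
  rewrite -(ler_pM2r u1) -mulrA -expr2 (le_trans (coer _ Tu)) //.
  by rewrite (le_trans (ler_norm _)) // rip_le.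
have Tinj u : dom T u -> T u = 0 -> u = 0.
  move=> Tu Tu0; apply: hnorm_eq0; apply/eqP; rewrite eq_le hnorm_ge0 andbT.
  by have := low u Tu; rewrite Tu0 hnorm0 pmulr_rle0.
have surj y : exists u, dom T u /\ T u = y.
  have hn (n : nat) : exists u, dom T u /\ hnorm (y - T u) < n.+1%:R^-1.
    have [|u] := @sa_range_dense Tinj y n.+1%:R^-1; last by exists u.
    by rewrite invr_gt0 ltr0n.
  have [x hx] := choice hn.
  have [l hl] : exists l, forall e : R, 0 < e ->
      exists N, forall n, (N <= n)%N -> hnorm (l - x n) < e.
    apply: hnorm_cauchy => r r0.
    have r20 : 0 < a * r / 2 by rewrite divr_gt0 // mulr_gt0.
    have [N hN] := inv_succ_lt r20; exists N => n Nn.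
    have [T1 e1] := hx N; have [T2 e2] := hx n.
    have [T3 e3] := lopB sa_lop T1 T2.
    rewrite -(ltr_pM2l a0) (le_lt_trans (low _ T3)) // e3.
    have -> : T (x N) - T (x n) = (T (x N) - y) + (y - T (x n)).
      by rewrite addrA subrK.
    rewrite (le_lt_trans (hnorm_triangle _ _)) // (hnorm_distC (T (x N))).
    move: (hN n Nn) (hN N (leqnn N)) e1 e2.
    by move: (n.+1%:R^-1) (N.+1%:R^-1) => *; lra.
  (* [T] is closed, being an adjoint: [rip (T v) l = rip v y] is the limit of the symmetry relation
     along [x n]. *)
  exists l; apply: sa_adjointP => v Tv.
  apply/eqP; rewrite -subr_eq0 -normr_le0 leNgt; apply/negP => del0.
  set del := `|_| in del0.
  pose c := hnorm (T v) + hnorm v + 1.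
  have c0 : 0 < c by rewrite ltr_wpDl // addr_ge0 // hnorm_ge0.
  have dc : 0 < del / c by rewrite divr_gt0.
  have [N1 hN1] := inv_succ_lt dc; have [N2 hN2] := hl _ dc.
  pose n := maxn N1 N2.
  have h1 := hN1 n (leq_maxl _ _); have h2 := hN2 n (leq_maxr _ _).
  have [T1 e1] := hx n.
  have e2 := lt_trans e1 h1.
  suff : del < del by rewrite ltxx.
  rewrite {1}/del.
  have -> : rip (T v) l - rip v y = rip (T v) (l - x n) - rip v (y - T (x n)).
    by rewrite !ripE (sa_sym Tv T1); ring.
  rewrite (le_lt_trans (ler_normB _ _)) //.
  have r1 := rip_le (T v) (l - x n); have r2 := rip_le v (y - T (x n)).
  have r3 := ler_wpM2l (hnorm_ge0 (T v)) (ltW h2).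
  have r4 := ler_wpM2l (hnorm_ge0 v) (ltW e2).
  have -> : del = (hnorm (T v) + hnorm v + 1) * (del / c).
    by rewrite -/c mulrCA divff ?mulr1 // gt_eqF.
  by move: (del / c) dc r1 r2 r3 r4 => q *; lra.
have [S hS] := choice surj.
have TS y : T (S y) = y by case: (hS y).
have dS y : dom T (S y) by case: (hS y).
have inj u v : dom T u -> dom T v -> T u = T v -> u = v.
  move=> Tu Tv e; have [Tw ew] := lopB sa_lop Tu Tv.
  by apply/eqP; rewrite -subr_eq0; apply/eqP/Tinj => //; rewrite ew e subrr.
have Slin : linear S.
  move=> b u v; have [Tw ew] := lop_lin sa_lop b (dS u) (dS v).
  by apply: inj => //; rewrite ew !TS.
pose L : {linear H -> H} := HB.pack S (GRing.isLinear.Build _ _ _ _ S Slin).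
exists L.
  exists a^-1 => u; rewrite mulrC ler_pdivlMr // mulrC.
  by rewrite (le_trans (low _ (dS u))) // TS.
split=> [v|u Tu] /=; first by rewrite TS scale0r subr0; split.
by rewrite scale0r subr0; apply: inj.
Qed.

End self_adjoint_operators.

(** * Spectral subspaces *)

Section spectral_measures.
Variables (R : realType) (H : hilbertSpace R) (E : resolution_of_identity H).
Implicit Types (X Y : set (measurableTypeR R)) (u v f g : H).

Lemma sproj_idem X u : measurable X -> sproj E X (sproj E X u) = sproj E X u.
Proof. by move=> mX; rewrite -sprojI // setIid. Qed.

Lemma sprojCA X Y u : measurable X -> measurable Y ->
  sproj E X (sproj E Y u) = sproj E Y (sproj E X u).
Proof. by move=> mX mY; rewrite -!sprojI // setIC. Qed.

Lemma rip_sproj X u v : measurable X -> rip (sproj E X u) v = rip u (sproj E X v).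
Proof. by move=> mX; rewrite /rip sproj_sym. Qed.

Lemma smeasure_rip u X : measurable X -> smeasure E u X = (rip (sproj E X u) u)%:E.
Proof. by move=> mX; rewrite smeasureE. Qed.

Lemma smeasure_hnorm u X : measurable X ->
  smeasure E u X = (hnorm (sproj E X u) ^+ 2)%:E.
Proof. by move=> mX; rewrite smeasure_rip // -sproj_idem // rip_sproj // sproj_idem // ripuu. Qed.

Lemma smeasureT u : smeasure E u setT = (hnorm u ^+ 2)%:E.
Proof. by rewrite smeasure_hnorm // sprojT. Qed.

Lemma smeasure_eq0 u X : measurable X -> smeasure E u X = 0%E <-> sproj E X u = 0.
Proof.
move=> mX; rewrite smeasure_hnorm //; split=> [[/eqP]|->]; last by rewrite hnorm0 expr0n.
by rewrite sqrf_eq0 => /eqP/hnorm_eq0.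
Qed.

Lemma sproj_set0 u : sproj E set0 u = 0.
Proof. by apply/smeasure_eq0 => //; rewrite measure0. Qed.

(** Additivity is only known for the scalar measures. The projections of [u] on [X] and its
    complement are orthogonal, so expanding the square norm of the difference of the two sides gives
    zero. *)
Lemma sprojC X u : measurable X -> sproj E (~` X) u = u - sproj E X u.
Proof.
move=> mX; have mXC := measurableC mX.
have : smeasure E u (X `|` ~` X) = (smeasure E u X + smeasure E u (~` X))%E.
  by rewrite measureU // setICr.
rewrite setUCr smeasureT !smeasure_rip // -EFinD => -[].
set p := sproj E X u; set q := sproj E (~` X) u => e.
have pq : rip p q = 0.
  by rewrite rip_sproj // -sprojI // setICr sproj_set0 rip0r.
have pp : rip p p = rip p u by rewrite rip_sproj // sproj_idem // ripC.
have qq : rip q q = rip q u by rewrite rip_sproj // sproj_idem // ripC.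
apply/eqP; rewrite -subr_eq0; apply/eqP/rip_eq0.
rewrite !ripE (ripC q p) (ripC u p) (ripC u q) pq pp qq ripuu e; ring.
Qed.

(** The projections commute, so the cross terms between the range and the kernel of [sproj E X]
    vanish. *)
Lemma smeasure_add X Y f g : measurable X -> measurable Y ->
  sproj E X f = f -> sproj E X g = 0 ->
  smeasure E (f + g) Y = (smeasure E f Y + smeasure E g Y)%E.
Proof.
move=> mX mY Xf Xg; rewrite !smeasure_rip // linearD !ripE -EFinD.
have fg : rip (sproj E Y f) g = 0.
  by rewrite -Xf sprojCA // rip_sproj // Xg rip0r.
have gf : rip (sproj E Y g) f = 0 by rewrite rip_sproj // ripC.
by rewrite fg gf; congr (_%:E); ring.
Qed.

End spectral_measures.

Section spectral_operator.
Variables (R : realType) (H : hilbertSpace R) (E : resolution_of_identity H).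
Variables (T : operator H) (hE : is_spectral_integral E id T).
Hypothesis Tsym : forall u v, dom T u -> dom T v -> rip (T u) v = rip u (T v).
Hypothesis Tdense : dense (dom T).
Implicit Types (X Y : set (measurableTypeR R)) (u v f g : H).

Let Tlin : linear_operator T. Proof. by case: hE. Qed.

Lemma spectral_domP u :
  dom T u <-> (\int[smeasure E u]_x (x ^+ 2)%:E < +oo)%E.
Proof. by case: hE. Qed.

Lemma spectral_rip u : dom T u -> rip (T u) u = \int[smeasure E u]_x x.
Proof. by case: hE => _ _ h /h; rewrite /rip => ->. Qed.

Lemma measurable_sqr : measurable_fun setT (fun x : measurableTypeR R => (x ^+ 2)%:E).
Proof. by apply/measurable_EFinP; exact: measurable_funX. Qed.

(** Because [|x| <= 1 + x^2] and the scalar measure is finite. *)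
Lemma spectral_integrable u : dom T u ->
  (smeasure E u).-integrable setT (fun x : measurableTypeR R => x%:E).
Proof.
move=> /spectral_domP Tu; apply/integrableP; split; first exact/measurable_EFinP.
have m1 : measurable_fun setT (fun x : measurableTypeR R => (1 + x ^+ 2)%:E).
  by apply/measurable_EFinP; apply: measurable_funD => //; exact: measurable_funX.
apply: (@le_lt_trans _ _ (\int[smeasure E u]_x (1 + x ^+ 2)%:E)%E).
  apply: ge0_le_integral => //.
  - by apply: measurableT_comp => //; exact/measurable_EFinP.
  - move=> x _ /=; rewrite lee_fin ler_norml.
    by apply/andP; split; nra.
under eq_integral do rewrite EFinD.
rewrite ge0_integralD //; last 2 first.
- by move=> x _; rewrite lee_fin sqr_ge0.
- exact: measurable_sqr.
by rewrite integral_cst // mul1e smeasureT lte_add_pinfty // ltry.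
Qed.

(** The second moment of [u] is the sum of those of its two pieces, so each piece has a finite
    one. *)
Lemma spectral_dom_split X u : measurable X -> dom T u ->
  dom T (sproj E X u) /\ dom T (u - sproj E X u).
Proof.
move=> mX Tu; set f := sproj E X u; set g := u - f.
have Xf : sproj E X f = f by exact: sproj_idem.
have Xg : sproj E X g = 0 by rewrite linearB /= Xf subrr.
have ge0 v : (0 <= \int[smeasure E v]_x (x ^+ 2)%:E)%E.
  by apply: integral_ge0 => x _; rewrite lee_fin sqr_ge0.
have : (\int[smeasure E u]_x (x ^+ 2)%:E =
    \int[smeasure E f]_x (x ^+ 2)%:E + \int[smeasure E g]_x (x ^+ 2)%:E)%E.
  rewrite -ge0_integral_measure_add //; last 2 first.
  - by move=> x _; rewrite lee_fin sqr_ge0.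
  - exact: measurable_sqr.
  apply: eq_measure_integral => Y mY _; apply: etrans (esym (measure_addE _ _ Y)).
  by rewrite -(smeasure_add mX) // addrC subrK.
move/spectral_domP: Tu => Tu e; rewrite e in Tu.
split; apply/spectral_domP; apply: le_lt_trans Tu; first by rewrite leeDl.
by rewrite leeDr.
Qed.

(** The integral of [x] is additive over the splitting, so the quadratic form of [T] at [f + g] has
    no cross term; by symmetry of [T] that term is [2 rip (T f) g]. *)
Lemma spectral_rip_cross X f g : measurable X ->
  sproj E X f = f -> dom T f -> sproj E X g = 0 -> dom T g -> rip (T f) g = 0.
Proof.
move=> mX Xf Tf Xg Tg; have [Tfg efg] := lopD Tlin Tf Tg.
have := spectral_rip Tfg.
have -> : \int[smeasure E (f + g)]_x x =
    \int[smeasure E f]_x x + \int[smeasure E g]_x x.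
  rewrite /Rintegral -fineD.
  - congr fine; rewrite -integral_measure_add //.
    + apply: eq_measure_integral => Y mY _.
      apply: etrans (esym (measure_addE _ _ Y)).
      by rewrite -(smeasure_add mX).
    + exact: spectral_integrable.
    + exact: spectral_integrable.
  - exact/integrable_fin_num/spectral_integrable.
  - exact/integrable_fin_num/spectral_integrable.
by rewrite -!spectral_rip // efg !ripE (Tsym Tg Tf) (ripC g); lra.
Qed.

(** The component of [T f] outside the spectral subspace is orthogonal to the dense domain: pairing
    it with [g] moves the projection onto [g], where [spectral_rip_cross] applies. *)
Lemma sproj_spectral X f : measurable X ->
  sproj E X f = f -> dom T f -> sproj E X (T f) = T f.
Proof.
move=> mX Xf Tf; set h := T f - sproj E X (T f).
suff h0 : h = 0 by apply/eqP; rewrite eq_sym -subr_eq0 -/h h0.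
apply: rip_eq0; apply/eqP; rewrite eq_le rip_ge0 andbT -[leRHS](mul0r (hnorm h)).
apply: rip_le_approx => // e e0; have [g Tg hg] := dense_hnorm Tdense h e0.
exists g => //; rewrite mul0r ripC ripDl ripNl rip_sproj // -ripNr -ripDr.
have [_ Tg'] := spectral_dom_split mX Tg.
by rewrite (spectral_rip_cross mX) // linearB /= sproj_idem // subrr.
Qed.

Lemma spectral_bounded_dom X f (b : R) : measurable X ->
  (forall x, X x -> `|x| <= b) -> sproj E X f = f -> dom T f.
Proof.
move=> mX Xb Xf; apply/spectral_domP.
have N0 : smeasure E f (~` X) = 0%E.
  by apply/(smeasure_eq0 _ _ (measurableC mX)); rewrite sprojC // Xf subrr.
rewrite (ge0_negligible_integral (measurableC mX) _ _ _ N0) //; last 2 first.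
- exact: measurable_sqr.
- by move=> x _; rewrite lee_fin sqr_ge0.
rewrite setTD setCK.
apply: (@le_lt_trans _ _ (\int[smeasure E f]_(x in X) (b ^+ 2)%:E)%E).
  apply: ge0_le_integral => //.
  - by move=> x _; rewrite lee_fin sqr_ge0.
  - exact: measurable_funTS measurable_sqr.
  - move=> x Xx; rewrite lee_fin -real_normK ?num_real //.
    by rewrite lerXn2r ?nnegrE ?Xb // (le_trans _ (Xb x Xx)).
by rewrite integral_cst // smeasure_hnorm // -EFinM ltry.
Qed.

(** The two bounds are separate because [X] may be a half-line. *)
Lemma spectral_rip_bounds X u : measurable X -> dom T u ->
  smeasure E u (~` X) = 0%E ->
  (forall a : R, (forall x, X x -> a <= x) -> a * hnorm u ^+ 2 <= rip (T u) u) /\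
  (forall b : R, (forall x, X x -> x <= b) -> rip (T u) u <= b * hnorm u ^+ 2).
Proof.
move=> mX Tu N0; have iu := spectral_integrable Tu.
have iX : (smeasure E u).-integrable X (EFin \o (id : measurableTypeR R -> R)).
  by apply: integrableS iu.
have -> : rip (T u) u = \int[smeasure E u]_(x in X) x.
  rewrite spectral_rip // /Rintegral.
  by rewrite (negligible_integral (measurableC mX) _ _ N0) // setTD setCK.
have sX : fine (smeasure E u X) = hnorm u ^+ 2.
  have : smeasure E u (X `|` ~` X) = (smeasure E u X + smeasure E u (~` X))%E.
    by rewrite measureU ?setICr //; exact: measurableC.
  by rewrite setUCr smeasureT N0 adde0 => <-.
have ic (a : R) : (smeasure E u).-integrable X (EFin \o cst a).
  apply/integrableP; split; first exact/measurable_EFinP.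
  by rewrite /= integral_cst // smeasure_hnorm // -EFinM ltry.
by split=> a aX; rewrite -sX -(Rintegral_cst _ mX); apply: le_Rintegral => //; exact: ic.
Qed.

(** Only the quadratic form of [T - mu] is controlled by the measure. Polarisation turns that into a
    norm bound by testing against a multiple of [S f], which stays in the spectral subspace by
    [sproj_spectral]. *)
Lemma spectral_approx X f (mu eps : R) : measurable X ->
  (forall x, X x -> mu - eps <= x <= mu + eps) -> sproj E X f = f ->
  hnorm (T f - mu%:C *: f) <= eps * hnorm f.
Proof.
move=> mX Xb Xf.
have dX g : sproj E X g = g -> dom T g.
  apply: (@spectral_bounded_dom X g (`|mu| + `|eps|)) => // x /Xb /andP[h1 h2].
  by rewrite ler_norml; apply/andP; split;
    have := ler_norm mu; have := ler_norm eps;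
    have := ler_norm (- mu); have := ler_norm (- eps); rewrite !normrN; lra.
pose S g := T g - mu%:C *: g.
have quad g : sproj E X g = g -> `|rip (S g) g| <= eps * rip g g.
  move=> Xg; have Tg := dX g Xg.
  have N0 : smeasure E g (~` X) = 0%E.
    by apply/(smeasure_eq0 _ _ (measurableC mX)); rewrite sprojC // Xg subrr.
  have [/(_ (mu - eps)) h1 /(_ (mu + eps)) h2] := spectral_rip_bounds mX Tg N0.
  have /h1 {h1} : forall x, X x -> mu - eps <= x by move=> x /Xb /andP[].
  have /h2 {h2} : forall x, X x -> x <= mu + eps by move=> x /Xb /andP[].
  rewrite -!ripuu ler_norml /S !ripE; lra.
have polar g : sproj E X g = g -> 2 * rip (S f) g <= eps * (rip f f + rip g g).
  move=> Xg; have Tf := dX f Xf; have Tg := dX g Xg.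
  have [_ e1] := lopD Tlin Tf Tg; have [_ e2] := lopB Tlin Tf Tg.
  have /quad : sproj E X (f + g) = f + g by rewrite linearD /= Xf Xg.
  have /quad : sproj E X (f - g) = f - g by rewrite linearB /= Xf Xg.
  rewrite !ler_norml /S e1 e2 !ripE (Tsym Tg Tf) (ripC g f) (ripC g (T f)).
  move=> /andP[h1 _] /andP[_ h2]; lra.
have XS : sproj E X (S f) = S f.
  by rewrite linearB linearZ /= Xf sproj_spectral //; exact: dX.
rewrite -/(S f); have [/hnorm_eq0 f0|f0] := eqVneq (hnorm f) 0.
  by rewrite /S f0 scaler0 (lop0 Tlin) subrr hnorm0 mulr0.
have f1 : 0 < hnorm f by rewrite lt0r f0 hnorm_ge0.
(* Here the claim is [0 <= eps * |f|]; the sign of [eps] is read off [quad]. *)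
have [->|s0] := eqVneq (hnorm (S f)) 0.
  have := quad f Xf; rewrite ripuu => /(le_trans (normr_ge0 _)).
  by rewrite pmulr_lge0 ?exprn_gt0 // => e0; rewrite mulr_ge0 // ltW.
have s1 : 0 < hnorm (S f) by rewrite lt0r s0 hnorm_ge0.
move: (S f) XS polar s0 s1 => z Xz polar s0 s1.
(* The multiple of [S f] with the same norm as [f] balances the two squares in [polar]. *)
have /polar : sproj E X ((hnorm f / hnorm (z))%:C *: z) =
    (hnorm f / hnorm (z))%:C *: z by rewrite linearZ /= Xz.
rewrite !ripE !ripuu.
have -> : hnorm f / hnorm (z) * hnorm (z) ^+ 2 = hnorm f * hnorm (z).
  by field.
have -> : hnorm f / hnorm (z) * (hnorm f * hnorm (z)) = hnorm f ^+ 2.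
  by field.
by move=> h; rewrite -(ler_pM2r f1); move: h; rewrite expr2; lra.
Qed.

(** These intervals partition []0, 1]], and with [mu = 1/(k+1)] the length [1/((k+1)(k+2))] is below
    [mu^2]. *)
Definition inv_succ_itv (k : nat) : set (measurableTypeR R) :=
  [set` `](k.+2%:R^-1 : R), k.+1%:R^-1]].

Lemma measurable_inv_succ_itv k : measurable (inv_succ_itv k).
Proof. exact: measurable_itv. Qed.

Hypothesis Tpos : forall u, dom T u -> u != 0 -> 0 < rip (T u) u.

(** Positivity leaves no spectral mass on []-oo, 0]], and the hypothesis leaves none on []0,
    1/(N+1)]], so every scalar measure lives on []1/(N+1), +oo[]. *)
Lemma spectral_coercive (N : nat) :
  (forall k f, (N <= k)%N -> sproj E (inv_succ_itv k) f = f -> f = 0) ->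
  exists2 a : R, 0 < a & forall u, dom T u -> a * hnorm u ^+ 2 <= rip (T u) u.
Proof.
move=> XN; exists N.+1%:R^-1; first by rewrite invr_gt0 ltr0n.
move=> u Tu.
(* The half-line is exhausted by bounded pieces, whose spectral vectors lie in the domain. Each
   contains 0, since strict positivity also excludes an atom there. *)
pose Z (n : nat) : set (measurableTypeR R) := [set` `[(- n%:R : R), 0]].
have mZ n : measurable (Z n) by exact: measurable_itv.
have Z0 n f : sproj E (Z n) f = f -> f = 0.
  move=> Zf; have Tf : dom T f.
    apply: (@spectral_bounded_dom (Z n) f n%:R) => // x.
    rewrite /Z /= in_itv => /andP[h1 h2]; rewrite ler_norml; apply/andP; split=> //.
    by rewrite (le_trans h2).
  apply/eqP/negPn/negP => f0; have := Tpos Tf f0.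
  have N0 : smeasure E f (~` Z n) = 0%E.
    by apply/(smeasure_eq0 _ _ (measurableC (mZ n))); rewrite sprojC // Zf subrr.
  have [_ /(_ 0)] := spectral_rip_bounds (mZ n) Tf N0.
  rewrite mul0r leNgt => h h'; have := h _; rewrite h' => /(_ _)/negP[] //.
  by move=> x; rewrite /Z /= in_itv /= => /andP[].
pose F n := Z n `|` inv_succ_itv (N + n).
have mF n : measurable (F n).
  by apply: measurableU => //; exact: measurable_inv_succ_itv.
have F0 : (smeasure E u).-negligible (\bigcup_n F n).
  apply: negligible_bigcup => n; apply: negligibleU.
    apply/negligibleP => //; apply/smeasure_eq0 => //.
    by apply: (Z0 n); exact: sproj_idem.
  have mI := measurable_inv_succ_itv (N + n).
  apply/negligibleP => //; apply/smeasure_eq0 => //.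
  by apply: (XN (N + n)%N); [exact: leq_addr|exact: sproj_idem].
pose X : set (measurableTypeR R) := [set` `](N.+1%:R^-1 : R), +oo[].
have mX : measurable X by exact: measurable_itv.
have CX : smeasure E u (~` X) = 0%E.
  apply/negligibleP; first exact: measurableC.
  apply: negligibleS F0 => x; rewrite /X /= in_itv /= andbT => /negP.
  rewrite -leNgt => xN.
  have [x0|x0] := leP x 0.
    exists (Num.truncn (- x)).+1 => //; left; rewrite /Z /= in_itv /= x0 andbT.
    by rewrite lerNl ltW // truncnS_gt.
  have ix0 : 0 < x^-1 by rewrite invr_gt0.
  (* Then [1/(m+1) < x <= 1/m], which is the interval of index [m - 1 = N + (m - (N+1))]. *)
  pose m := Num.truncn x^-1.
  have [m1 m2] : m%:R <= x^-1 /\ x^-1 < m.+1%:R.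
    by have /andP[] := truncn_itv (ltW ix0).
  have Nm : (N.+1 <= m)%N.
    by rewrite (truncn_ge_nat _ (ltW ix0)) -[leLHS]invrK lef_pV2 ?posrE // invr_gt0 ltr0n.
  exists (m - N.+1)%N => //; right; rewrite /inv_succ_itv /= in_itv /=.
  have -> : (N + (m - N.+1)).+1 = m by rewrite -addSn subnKC.
  have m0 : (0 < m)%N by exact: leq_trans Nm.
  rewrite invf_plt ?posrE ?ltr0n // m2 /=.
  by rewrite -[leLHS]invrK lef_pV2 ?posrE ?ltr0n.
have [/(_ N.+1%:R^-1) + _] := spectral_rip_bounds mX Tu CX; apply.
by move=> x; rewrite /X /= in_itv /= andbT => /ltW.
Qed.

End spectral_operator.

(** * Contraction semigroups *)

Lemma is_derive_error (R : realType) (f : R -> R) (t d : R) :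
  (forall e : R, 0 < e -> exists2 del : R, 0 < del &
    forall h, 0 < `|h| < del -> `|f (t + h) - f t - h * d| <= e * `|h|) ->
  is_derive t 1 f d.
Proof.
move=> hf.
have cv : (fun h : R => h^-1 *: ((f \o shift t) (h *: (1 : R)) - f t)) @ 0^' --> d.
  apply/cvgrPdist_le => e e0; have [del del0 hdel] := hf e e0.
  apply/nbhs_ballP; exists del => //= h; rewrite -ball_normE /= sub0r normrN => hd h0.
  have h1 : 0 < `|h| by rewrite normr_gt0.
  have := hdel h; rewrite h1 hd => /(_ isT).
  have -> : d - h^-1 *: (f (h *: 1 + t) - f t) = - (f (t + h) - f t - h * d) / h.
    by rewrite /GRing.scale /= mulr1 (addrC h); field.
  by rewrite normrM normrN normfV ler_pdivrMr.
apply: DeriveDef; first by apply/cvg_ex; exists d.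
exact: cvg_lim cv.
Qed.

Lemma at_right0P (R : realType) (P : R -> Prop) :
  (\forall h \near (0 : R)^'+, P h) <->
  exists2 d : R, 0 < d & forall h, 0 < h < d -> P h.
Proof.
split=> [/nbhs_ballP[d /= d0 hd]|[d d0 hd]].
  exists d => // h /andP[h0 hh]; apply: hd => //.
  by rewrite -ball_normE /= sub0r normrN gtr0_norm.
apply/nbhs_ballP; exists d => //= h; rewrite -ball_normE /= sub0r normrN => hh h0.
by apply: hd; rewrite h0 (le_lt_trans (ler_norm _)).
Qed.

Section energy_norm0.
Variables (R : realType) (H H1 : hilbertSpace R).
Implicit Types x : (H1 * H)%type.

Lemma norm0_ge0 x : 0 <= norm0 x.
Proof. exact: sqrtr_ge0. Qed.

Lemma norm0_fst x : hnorm x.1 <= norm0 x.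
Proof.
rewrite -[leLHS]ger0_norm ?hnorm_ge0 // -sqrtr_sqr.
by rewrite ler_sqrt ?addr_ge0 ?sqr_ge0 // lerDl sqr_ge0.
Qed.

Lemma norm0_snd x : hnorm x.2 <= norm0 x.
Proof.
rewrite -[leLHS]ger0_norm ?hnorm_ge0 // -sqrtr_sqr.
by rewrite ler_sqrt ?addr_ge0 ?sqr_ge0 // lerDr sqr_ge0.
Qed.

Lemma norm0_le x : norm0 x <= hnorm x.1 + hnorm x.2.
Proof.
have h0 : 0 <= hnorm x.1 + hnorm x.2 by rewrite addr_ge0 ?hnorm_ge0.
rewrite -[leRHS]ger0_norm // -sqrtr_sqr ler_sqrt ?sqr_ge0 //.
by have := hnorm_ge0 x.1; have := hnorm_ge0 x.2; nra.
Qed.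

Lemma norm0Z (a : R) x : norm0 (a%:C *: x) = `|a| * norm0 x.
Proof.
rewrite /norm0 /= !hnorm_scale !exprMn -mulrDr sqrtrM ?sqr_ge0 //.
by rewrite sqrtr_sqr normr_id.
Qed.

Lemma cvg_norm0P {T : Type} {F : set_system T} {FF : Filter F}
    (f : T -> (H1 * H)%type) x :
  f @ F --> x <-> forall e : R, 0 < e -> \forall y \near F, norm0 (x - f y) < e.
Proof.
split=> [fx e e0|h].
  have e20 : 0 < e / 2 by rewrite divr_gt0.
  have f1 : (fun y => (f y).1) @ F --> x.1 by apply: cvg_comp fx _; exact: cvg_fst.
  have f2 : (fun y => (f y).2) @ F --> x.2 by apply: cvg_comp fx _; exact: cvg_snd.
  move/cvg_hnormP: f1 => /(_ _ e20); move/cvg_hnormP: f2 => /(_ _ e20).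
  apply: filterS2 => y h2 h1; apply: le_lt_trans (norm0_le _) _.
  by rewrite [ltRHS](splitr e); apply: ltrD.
have f1 : (fun y => (f y).1) @ F --> x.1.
  apply/cvg_hnormP => e /h; apply: filterS => y; apply: le_lt_trans.
  exact: (norm0_fst (x - f y)).
have f2 : (fun y => (f y).2) @ F --> x.2.
  apply/cvg_hnormP => e /h; apply: filterS => y; apply: le_lt_trans.
  exact: (norm0_snd (x - f y)).
have := cvg_pair f1 f2.
have -> : (fun y => ((f y).1, (f y).2)) = f by apply/funext => y; case: (f y).
by move=> /(_ _ _ _); exact.
Qed.

End energy_norm0.

Section semigroup.
Variables (R : realType) (H H1 : hilbertSpace R).
Variables (U : R -> {linear (H1 * H)%type -> (H1 * H)%type}).
Hypothesis hU : contraction_semigroup U.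
Variables (x y : (H1 * H)%type).
Hypothesis hxy : (fun h => (h^-1)%:C *: (U h x - x)) @ 0^'+ --> y.

Let UB t a b : U t (a - b) = U t a - U t b. Proof. exact: linearB. Qed.

Let UZ t r a : U t (r *: a) = r *: U t a. Proof. exact: linearZZ. Qed.

(** The difference quotient at [U t x] is [U t] applied to the one at [x], and [U t] is a
    contraction; the generator domain is thus invariant. *)
Lemma semigroup_cvg_image (t : R) : 0 <= t ->
  (fun h => (h^-1)%:C *: (U h (U t x) - U t x)) @ 0^'+ --> U t y.
Proof.
move=> t0; case: hU => _ Uadd _ Uc; apply/cvg_norm0P => e e0.
move/cvg_norm0P: hxy => /(_ _ e0) /at_right0P [d d0 hd].
apply/at_right0P; exists d => // h /[dup] hhd /hd; apply: le_lt_trans.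
have h0 : 0 <= h by case/andP: hhd => /ltW.
have -> : U t y - (h^-1)%:C *: (U h (U t x) - U t x) = U t (y - (h^-1)%:C *: (U h x - x)).
  have -> : U h (U t x) = U t (U h x) by rewrite -!Uadd // addrC.
  by rewrite -UB -UZ -UB.
exact: Uc.
Qed.

Lemma semigroup_error (e : R) : 0 < e -> exists2 d : R, 0 < d &
  forall h, 0 < h < d -> norm0 (U h x - x - h%:C *: y) <= e * h /\ norm0 (y - U h y) <= e.
Proof.
move=> e0; case: hU => _ Uadd Ucvg Uc.
move/cvg_norm0P: hxy => /(_ _ e0) /at_right0P [d1 d10 hd1].
have /cvg_norm0P /(_ _ e0) /at_right0P [d2 d20 hd2] := Ucvg y.
exists (Num.min d1 d2); first by rewrite lt_min d10.
move=> h /andP[h0]; rewrite lt_min => /andP[h1 h2]; split; last first.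
  by apply/ltW/hd2; rewrite h0.
have -> : U h x - x - h%:C *: y = (- h)%:C *: (y - (h^-1)%:C *: (U h x - x)).
  rewrite scalerBr scalerA -rmorphM mulNr divff ?gt_eqF // rmorphN rmorph1.
  by rewrite rmorphN !scaleNr scale1r opprK addrC.
rewrite norm0Z normrN gtr0_norm // mulrC ler_pM2r //.
by apply/ltW/hd1; rewrite h0.
Qed.

Variables (l : (H1 * H)%type -> R) (K : R).
Hypothesis lD : forall a b, l (a + b) = l a + l b.
Hypothesis lZ : forall (r : R) a, l (r%:C *: a) = r * l a.
Hypothesis lK : forall a, `|l a| <= K * norm0 a.

Let lB a b : l (a - b) = l a - l b.
Proof.
have -> : - b = (- 1)%:C *: b by rewrite rmorphN rmorph1 scaleN1r.
by rewrite lD lZ mulN1r.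
Qed.

Let lK1 a (e : R) : 0 <= e -> norm0 a <= e -> `|l a| <= (`|K| + 1) * e.
Proof.
move=> e0 ae; apply: le_trans (lK a) _.
have := ler_norm K; have := normr_ge0 K; have := norm0_ge0 a.
move: (norm0 a) `|K| ae => n k; nra.
Qed.

(** The limit defining the generator is one-sided. For [h < 0] the increment is rebased at [t + h],
    at the cost of the error [y - U (- h) y], which the second half of [semigroup_error]
    controls. *)
Lemma semigroup_derive (t : R) : 0 < t -> is_derive t 1 (fun s => l (U s x)) (l (U t y)).
Proof.
move=> t0; case: hU => _ Uadd _ Uc; apply: is_derive_error => e e0.
pose k := `|K| + 1; have k0 : 0 < k by rewrite ltr_wpDl.
have e10 : 0 < e / 2 / k by rewrite !divr_gt0.
have [d d0 hd] := semigroup_error e10.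
exists (Num.min d t); first by rewrite lt_min d0.
move=> h /andP[h0]; rewrite lt_min => /andP[h1 h2].
have [hp|hn] := ltP 0 h.
  move: h1; rewrite gtr0_norm // => h1.
  have -> : U (t + h) x = U t (U h x) by rewrite Uadd // ltW.
  rewrite -lZ -!lB -UZ -!UB.
  have [|eh _] := hd h; first by rewrite hp.
  have /lK1 : norm0 (U t (U h x - x - h%:C *: y)) <= e / 2 / k * h.
    by apply: le_trans eh; apply: Uc; exact: ltW.
  have e1h : 0 <= e / 2 / k * h by rewrite mulr_ge0 // ltW.
  move=> /(_ e1h) hle; apply: le_trans hle _; rewrite -/k.
  rewrite mulrA mulrCA divff ?gt_eqF // mulr1 ler_pM2r //; lra.
have hn0 : h < 0 by rewrite lt_neqAle hn andbT -normr_gt0.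
move: h1 h2; rewrite ltr0_norm // => h1 h2.
pose q := - h; have q0 : 0 < q by rewrite oppr_gt0.
have [|e1 e2] := hd q; first by rewrite q0.
have tq : 0 <= t - q by rewrite subr_ge0 ltW.
have hq : h = - q by rewrite opprK.
rewrite hq.
have Utx w : U t w = U (t - q) (U q w) by rewrite -Uadd ?subrK // ltW.
have -> : l (U (t - q) x) - l (U t x) - - q * l (U t y) =
   - l (U (t - q) (U q x - x - q%:C *: y)) - q * l (U (t - q) (y - U q y)).
  by rewrite !Utx !UB UZ !lB lZ; ring.
have n1 : `|l (U (t - q) (U q x - x - q%:C *: y))| <= k * (e / 2 / k * q).
  apply: lK1; first by rewrite mulr_ge0 // ltW.
  by apply: le_trans e1; exact: Uc.
have n2 : `|l (U (t - q) (y - U q y))| <= k * (e / 2 / k).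
  by apply: lK1; [exact: ltW|apply: le_trans e2; exact: Uc].
apply: le_trans (ler_normB _ _) _; rewrite normrN [in X in _ + X]normrM (gtr0_norm q0).
have ek : k * (e / 2 / k) = e / 2 by rewrite mulrCA divff ?gt_eqF // mulr1.
rewrite ek in n2; rewrite mulrA ek in n1.
have := ler_wpM2l (ltW q0) n2; lra.
Qed.

Lemma semigroup_cvg0 (w : (H1 * H)%type) : (fun s => l (U s w)) @ 0^'+ --> l w.
Proof.
case: hU => _ Uadd Ucvg Uc; apply/cvgrPdist_le => e e0.
pose k := `|K| + 1; have k0 : 0 < k by rewrite ltr_wpDl.
have ek : 0 < e / k by rewrite divr_gt0.
have /cvg_norm0P /(_ _ ek) := Ucvg w; apply: filterS => h hh.
rewrite -lB; apply: le_trans (lK1 (ltW ek) (ltW hh)) _.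
by rewrite -/k mulrCA divff ?gt_eqF // mulr1.
Qed.

(** Passing through a bounded real functional [l] gives a mean value theorem for the vector-valued
    orbit. *)
Lemma semigroup_MVT (s t : R) : 0 <= s -> s < t ->
  exists2 r, s < r < t & l (U t x) - l (U s x) = l (U r y) * (t - s).
Proof.
move=> s0 st; case: (hU) => U0 _ _ _.
have der (r : R) : 0 < r -> is_derive r 1 (fun s => l (U s x)) (l (U r y)).
  exact: semigroup_derive.
have cont (r : R) : 0 < r -> {for r, continuous (fun s => l (U s x))}.
  by move=> /der dr; apply/differentiable_continuous/derivable1_diffP; exact: ex_derive.
have [||r] := @MVT R (fun s => l (U s x)) (fun r => l (U r y)) s t st.
- by move=> r; rewrite in_itv /= => /andP[sr _]; apply: der; exact: le_lt_trans sr.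
- apply/continuous_within_itvP => //; split.
  + by move=> r; rewrite in_itv /= => /andP[sr _]; apply: cont; exact: le_lt_trans sr.
  + have [s1|] := ltP 0 s; first exact/cvg_at_right_filter/cont.
    move=> s1; have -> : s = 0 by apply/eqP; rewrite eq_le s1.
    by rewrite U0; exact: semigroup_cvg0.
  + exact/cvg_at_left_filter/cont/(le_lt_trans s0).
- by rewrite in_itv /= => rst ?; exists r.
Qed.

End semigroup.

(** * The damped wave equation in H *)

Lemma rip_pos (R : realType) (H : hilbertSpace R) (T : operator H) :
  positive_operator T -> forall u, dom T u -> u != 0 -> 0 < rip (T u) u.
Proof. by move=> Tp u Tu u0; have := Tp u Tu u0; rewrite ltcE => /andP[]. Qed.

Section energy_completion.
Variables (R : realType) (H H1 : hilbertSpace R) (A sqrtA : operator H).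
Variable (iota : H -> H1).
Hypothesis (hA : self_adjoint A) (hS : is_sqrt A sqrtA).
Hypothesis hiota : is_energy_completion A sqrtA iota.
Implicit Types u v : H.

Lemma sqrt_dom u : dom A u -> dom sqrtA u.
Proof. by case: hS => _ _ h _ /h[]. Qed.

Lemma sqrt_lop : linear_operator sqrtA.
Proof. by case: hS => /sa_lop. Qed.

Lemma rip_iota u v : dom sqrtA u -> dom sqrtA v ->
  rip (iota u) (iota v) = rip (sqrtA u) (sqrtA v).
Proof.
move=> Su Sv; case: hiota => ilin inorm _.
have iD : iota (u + v) = iota u + iota v by rewrite -[u]scale1r ilin // !scale1r.
have [Suv euv] := lopD sqrt_lop Su Sv.
have := inorm _ Suv; have := inorm _ Su; have := inorm _ Sv.
move=> /(congr1 (fun x => x ^+ 2)) h1 /(congr1 (fun x => x ^+ 2)) h2 /(congr1 (fun x => x ^+ 2)).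
move: h1 h2; rewrite -!ripuu iD euv !ripE (ripC (iota v) (iota u)) (ripC (sqrtA v) (sqrtA u)).
lra.
Qed.

(** The bridge from energy space to [H]: one factor [sqrtA] is moved across, so that pairings with
    the range of [A] make sense of [u] in [H]. *)
Lemma rip_iotaA u v : dom sqrtA u -> dom A v -> rip (iota u) (iota v) = rip u (A v).
Proof.
move=> Su Av; rewrite rip_iota //; last exact: sqrt_dom.
case: hS => sa _ hd he; have /hd [Sv SSv] := Av.
by rewrite he // (sa_sym sa).
Qed.

Lemma extends_to_iota u : dom A u -> extends_to sqrtA iota (iota u) (A u).
Proof.
move=> Au v Sv; have Sa := sqrt_dom Au; case: hiota => ilin _ _.
have [Ai ei] := lopZ (sa_lop hA) 'i%C Au.
have i0 : iota 0 = 0.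
  have := ilin 1 _ _ (lop_dom0 sqrt_lop) (lop_dom0 sqrt_lop).
  rewrite !scale1r addr0 => /eqP; rewrite -subr_eq subrr => /eqP <- //.
have iZ : iota ('i%C *: u) = 'i%C *: iota u.
  have := ilin 'i%C _ _ Sa (lop_dom0 sqrt_lop).
  by rewrite i0 !addr0.
apply: rip_inner_eq; first by rewrite ripC rip_iotaA // ripC.
by rewrite -iZ ripC rip_iotaA // ripC ei.
Qed.

End energy_completion.

(** Meant for [w] in the dense range of [A], where pairings with the solution are known. *)
Lemma hnorm_le_approx (R : realType) (H : hilbertSpace R) (d : H) (a : R) : 0 <= a ->
  (forall e, 0 < e -> exists2 w, hnorm (d - w) < e & rip w d <= a * hnorm w) ->
  hnorm d <= a.
Proof.
move=> a0 /(rip_le_approx a0); rewrite ripuu expr2.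
have [->//|d0] := eqVneq (hnorm d) 0.
by rewrite ler_pM2r // lt0r d0 hnorm_ge0.
Qed.

Section damped_wave_solution.
Variables (R : realType) (H H1 : hilbertSpace R) (A sqrtA : operator H).
Variables (B : {linear H -> H}) (iota : H -> H1).
Hypothesis (hA : self_adjoint A) (Apos : positive_operator A).
Hypothesis Bsym : forall u v, rip (B u) v = rip u (B v).
Hypothesis (hS : is_sqrt A sqrtA) (hiota : is_energy_completion A sqrtA iota).
Variables (U : R -> {linear (H1 * H)%type -> (H1 * H)%type}).
Hypothesis (hU : contraction_semigroup U).
Hypothesis hUgen : is_generator (wave_generator sqrtA B iota) U.
Variable (u : R -> H -> H -> H).
Hypothesis hu : is_wave_solution sqrtA iota U u.
Variables (u0 u1 : H).
Hypothesis (hu0 : dom A u0) (hu1 : dom sqrtA u1).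

Let x0 : (H1 * H)%type := (iota u0, u1).
Let y0 : (H1 * H)%type := (iota u1, - A u0 - B u1).
Let w (t : R) : H := u t u0 u1.
Let v (t : R) : H := (U t x0).2.

Let gen0 : (fun h => (h^-1)%:C *: (U h x0 - x0)) @ 0^'+ --> y0.
Proof.
apply/hUgen; split => //.
by exists (A u0) => //; exact: extends_to_iota.
Qed.

Let gen t : 0 <= t -> wave_generator sqrtA B iota (U t x0) (U t y0).
Proof. by move=> t0; apply/hUgen; exact: semigroup_cvg_image. Qed.

Let iotaw (t : R) : 0 <= t -> dom sqrtA (w t) /\ iota (w t) = (U t x0).1.
Proof. by move=> t0; apply: hu => //; exact: (sqrt_dom hS). Qed.

Let sv (t : R) : 0 <= t -> dom sqrtA (v t).
Proof. by case/gen. Qed.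

Let Ainj a : dom A a -> A a = 0 -> a = 0.
Proof.
move=> Aa Aa0; apply/eqP/negPn/negP => /(rip_pos Apos Aa).
by rewrite Aa0 rip0l ltxx.
Qed.

(** Along the orbit, [l1 a] is the pairing of [w] with [A a] (see [wA]), a bounded functional on the
    energy space to which the semigroup lemmas apply. *)
Let l1 (a : H) (z : (H1 * H)%type) : R := rip z.1 (iota a).
Let l2 (a : H) (z : (H1 * H)%type) : R := rip z.2 a.

Let l1D a x y : l1 a (x + y) = l1 a x + l1 a y. Proof. exact: ripDl. Qed.
Let l2D a x y : l2 a (x + y) = l2 a x + l2 a y. Proof. exact: ripDl. Qed.
Let l1Z a (r : R) x : l1 a (r%:C *: x) = r * l1 a x. Proof. exact: ripZl. Qed.
Let l2Z a (r : R) x : l2 a (r%:C *: x) = r * l2 a x. Proof. exact: ripZl. Qed.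
Let l1K a x : `|l1 a x| <= hnorm (iota a) * norm0 x.
Proof.
apply: le_trans (rip_le _ _) _; rewrite mulrC ler_wpM2l ?hnorm_ge0 //.
exact: norm0_fst.
Qed.
Let l2K a x : `|l2 a x| <= hnorm a * norm0 x.
Proof.
apply: le_trans (rip_le _ _) _; rewrite mulrC ler_wpM2l ?hnorm_ge0 //.
exact: norm0_snd.
Qed.

Let wA (t : R) a : 0 <= t -> dom A a -> rip (w t) (A a) = l1 a (U t x0).
Proof.
by move=> t0 Aa; have [Sw ew] := iotaw t0; rewrite /l1 -ew (rip_iotaA hS hiota).
Qed.

Let vA (t : R) a : 0 <= t -> dom A a -> rip (v t) (A a) = l1 a (U t y0).
Proof.
move=> t0 Aa; have [_ e _] := gen t0; rewrite /l1 e.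
by rewrite (rip_iotaA hS hiota) //; exact: sv.
Qed.

(** What is given is [iota (w 0) = iota u0]; pairing with the dense range of [A] brings the equality
    back to [H]. *)
Lemma wave_initial : w 0 = u0.
Proof.
apply/eqP; rewrite -subr_eq0; apply/eqP/hnorm_eq0/eqP.
rewrite eq_le hnorm_ge0 andbT; apply: hnorm_le_approx => // e e0.
have [a Aa ha] := sa_range_dense hA Ainj (w 0 - u0) e0.
exists (A a) => //; rewrite mul0r ripC ripDl ripNl wA // /l1.
case: hU => -> _ _ _; rewrite (rip_iotaA hS hiota) //; last exact: (sqrt_dom hS).
by rewrite subrr.
Qed.

Lemma wave_velocity_initial : v 0 = u1.
Proof. by rewrite /v; case: hU => ->. Qed.

Lemma wave_velocity_le (t : R) : 0 <= t -> hnorm (v t) <= norm0 x0.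
Proof.
move=> t0; apply: le_trans (norm0_snd _) _.
by case: hU => _ _ _; apply.
Qed.

(** The derivative of the orbit of [x0] is the orbit of [y0], which stays below [norm0 y0]; the
    functional is the pairing with the increment itself. *)
Lemma wave_velocity_lipschitz (s t : R) : 0 <= s -> s <= t ->
  hnorm (v t - v s) <= norm0 y0 * (t - s).
Proof.
move=> s0; rewrite le_eqVlt => /predU1P[->|st].
  by rewrite !subrr hnorm0 mulr0.
set d := v t - v s; have ts : 0 <= norm0 y0 * (t - s).
  by rewrite mulr_ge0 ?norm0_ge0 // subr_ge0 ltW.
have [d0|d0] := eqVneq (hnorm d) 0; first by rewrite d0.
have d1 : 0 < hnorm d by rewrite lt0r d0 hnorm_ge0.
rewrite -(ler_pM2r d1) -expr2 -ripuu.
have [r /andP[sr _]] := semigroup_MVT hU gen0 (l2D d) (l2Z d) (l2K d) s0 st.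
rewrite {1}/l2 -/(v t) {1}/l2 -/(v s) -ripNl -ripDl -/d => ->.
rewrite mulrC (mulrC (norm0 _)) -mulrA ler_pM2l ?subr_gt0 //.
apply: le_trans (ler_norm _) _; apply: le_trans (l2K _ _) _.
rewrite mulrC ler_wpM2r ?hnorm_ge0 //; case: hU => _ _ _; apply.
exact/ltW/(le_lt_trans s0).
Qed.

(** Against [A a] close to the increment, the mean value theorem yields a velocity [v r], bounded by
    contraction. In particular [w] grows at most linearly. *)
Lemma wave_lipschitz (s t : R) : 0 <= s -> s <= t ->
  hnorm (w t - w s) <= norm0 x0 * (t - s).
Proof.
move=> s0; rewrite le_eqVlt => /predU1P[->|st].
  by rewrite !subrr hnorm0 mulr0.
have ts : 0 < t - s by rewrite subr_gt0.
apply: hnorm_le_approx => [|e e0]; first by rewrite mulr_ge0 ?norm0_ge0 // ltW.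
have [a Aa ha] := sa_range_dense hA Ainj (w t - w s) e0.
exists (A a) => //; rewrite ripC ripDl ripNl !wA //; last by rewrite ltW // (le_lt_trans s0).
have [r /andP[sr _] ->] := semigroup_MVT hU gen0 (l1D a) (l1Z a) (l1K a) s0 st.
have r0 : 0 <= r by exact/ltW/(le_lt_trans s0).
rewrite -vA // mulrC (mulrC (norm0 _)) -mulrA ler_pM2l //.
apply: le_trans (ler_norm _) _; apply: le_trans (rip_le _ _) _.
by rewrite ler_wpM2r ?hnorm_ge0 // wave_velocity_le.
Qed.

(** First-order Taylor estimate: the intermediate velocity [v r] is replaced by [v s] using the
    Lipschitz bound. *)
Lemma wave_error (s t : R) : 0 <= s -> s < t ->
  hnorm (w t - w s - (t - s)%:C *: v s) <= norm0 y0 * (t - s) ^+ 2.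
Proof.
move=> s0 st; set d := w t - w s - _.
have ts : 0 < t - s by rewrite subr_gt0.
apply: hnorm_le_approx => [|e e0]; first by rewrite mulr_ge0 ?norm0_ge0 // sqr_ge0.
have [a Aa ha] := sa_range_dense hA Ainj d e0.
exists (A a) => //; rewrite ripC /d !ripE !wA //; last by rewrite ltW // (le_lt_trans s0).
have [r /andP[sr rt] ->] := semigroup_MVT hU gen0 (l1D a) (l1Z a) (l1K a) s0 st.
have r0 : 0 <= r by exact/ltW/(le_lt_trans s0).
rewrite -vA // mulrC -mulrBr -ripNl -ripDl.
rewrite expr2 mulrCA -mulrA ler_pM2l //.
apply: le_trans (ler_norm _) _; apply: le_trans (rip_le _ _) _.
rewrite ler_wpM2r ?hnorm_ge0 //.
apply: le_trans (wave_velocity_lipschitz s0 (ltW sr)) _.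
by rewrite ler_wpM2l ?norm0_ge0 // lerB // ltW.
Qed.

(** Here [b] is any vector of [H], no longer in the range of [A]. [wave_error] is based at the left
    endpoint, so [h < 0] needs a further change of velocity; hence the factor 2. *)
Lemma wave_derive (t : R) b : 0 < t ->
  is_derive t 1 (fun s => rip (w s) b) (rip (v t) b).
Proof.
move=> t0; apply: is_derive_error => e e0.
pose k := 2 * norm0 y0 * hnorm b + 1.
have k0 : 0 < k by rewrite ltr_wpDl // !mulr_ge0 // ?norm0_ge0 ?hnorm_ge0.
exists (Num.min (e / k) t); first by rewrite lt_min divr_gt0.
move=> h /andP[h0]; rewrite lt_min => /andP[h1 h2].
suff main : `|rip (w (t + h)) b - rip (w t) b - h * rip (v t) b| <=
    2 * norm0 y0 * hnorm b * `|h| ^+ 2.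
  apply: le_trans main _; rewrite expr2 mulrA ler_pM2r //.
  have : k * `|h| <= e by rewrite mulrC -ler_pdivlMr // ltW.
  by rewrite /k; nra.
have n0 := norm0_ge0 y0; have b0 := hnorm_ge0 b.
have [hp|hn] := ltP 0 h.
  have -> : rip (w (t + h)) b - rip (w t) b - h * rip (v t) b =
      rip (w (t + h) - w t - (t + h - t)%:C *: v t) b.
    by rewrite !ripE; ring.
  apply: le_trans (rip_le _ _) _.
  have := @wave_error t (t + h) (ltW t0) _; rewrite ltrDl => /(_ hp) he.
  apply: le_trans (ler_wpM2r b0 he) _.
  rewrite (addrC t) addrK gtr0_norm //.
  have := mulr_ge0 (mulr_ge0 n0 b0) (sqr_ge0 h); lra.
have hn0 : h < 0 by rewrite lt_neqAle hn andbT -normr_gt0.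
move: h1 h2; rewrite ltr0_norm // => h1 h2.
have th : 0 <= t + h by lra.
have tht : t + h < t by lra.
have -> : rip (w (t + h)) b - rip (w t) b - h * rip (v t) b =
    - rip (w t - w (t + h) - (t - (t + h))%:C *: v (t + h)) b -
    h * rip (v t - v (t + h)) b.
  by rewrite !ripE; ring.
have e1 := wave_error th tht; have e2 := wave_velocity_lipschitz th (ltW tht).
apply: le_trans (ler_normB _ _) _; rewrite normrN normrM ltr0_norm //.
have l1' := le_trans (rip_le _ b) (ler_wpM2r b0 e1).
have l2' := le_trans (rip_le _ b) (ler_wpM2r b0 e2).
have hh : 0 <= - h by lra.
have := ler_wpM2l hh l2'; move: l1'.
by move: `|rip (_ - _ - _) b| `|rip (v t - _) b| => ? ?; lra.
Qed.

(** The second generator component contains the extension [z] of [A] applied to [w]; pairing with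
    [b] in the domain of [A] puts [A] on [b]. *)
Lemma wave_velocity_derive (t : R) b : 0 < t -> dom A b ->
  is_derive t 1 (fun s => rip (v s) b) (- rip (w t) (A b) - rip (v t) (B b)).
Proof.
move=> t0 Ab; have := semigroup_derive hU gen0 (l2D b) (l2Z b) (l2K b) t0.
have [_ _ [z zext]] := gen (ltW t0).
rewrite [X in is_derive _ _ _ X]/l2 => ->; rewrite ripDl !ripNl Bsym.
have -> // : rip z b = rip (w t) (A b).
have := zext b (sqrt_dom hS Ab) => /(congr1 (@complex.Re R)).
by rewrite -/(rip _ _) -/(rip _ _) => <-; rewrite wA // ltW.
Qed.

Let cvg_right (f : R -> R) (L l : R) : 0 <= L ->
  (forall t, 0 < t -> `|l - f t| <= L * t) -> f t @[t --> 0^'+] --> l.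
Proof.
move=> L0 hf; apply/cvgrPdist_le => e e0; apply/at_right0P.
have L1 : 0 < L + 1 by rewrite ltr_wpDl.
exists (e / (L + 1)); first by rewrite divr_gt0.
move=> h /andP[h0]; rewrite ltr_pdivlMr // => he.
by apply: le_trans (hf h h0) _; lra.
Qed.

(* Pairing the equation with the test function [p.[t] *: psi] and integrating
   by parts twice in time. *)
Lemma wave_MVT (psi : H) (p : {poly R}) (s t : R) : dom A psi -> 0 <= s -> s < t ->
  let G := fun t => (rip (v t) psi + rip (w t) (B psi)) * p.[t] - rip (w t) psi * p^`().[t] in
  exists2 r, s < r < t & G t - G s =
    (- rip (w r) (A psi) * p.[r] + rip (w r) (B psi) * p^`().[r] -
      rip (w r) psi * p^`()^`().[r]) * (t - s).
Proof.
move=> Apsi s0 st G.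
pose D r := - rip (w r) (A psi) * p.[r] + rip (w r) (B psi) * p^`().[r] -
      rip (w r) psi * p^`()^`().[r].
have dp (q : {poly R}) (r : R) : is_derive r 1 (horner q) q^`().[r].
  apply: DeriveDef; first exact: derivable_horner.
  by rewrite derivE derive1E.
have der (r : R) : 0 < r -> is_derive r 1 G (D r).
  move=> r0.
  have d1 := wave_velocity_derive r0 Apsi.
  have d2 := wave_derive (B psi) r0.
  have d3 := wave_derive psi r0.
  have d := is_deriveB (is_deriveM (is_deriveD d1 d2) (dp p r)) (is_deriveM d3 (dp p^`() r)).
  apply: (is_derive_eq d); rewrite /D /GRing.scale /= !fctE; ring.
have cont (r : R) : 0 < r -> {for r, continuous G}.
  by move=> /der dr; apply/differentiable_continuous/derivable1_diffP; exact: ex_derive.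
have [||r] := @MVT R G D s t st.
- by move=> r; rewrite in_itv /= => /andP[sr _]; apply: der; exact: le_lt_trans sr.
- apply/continuous_within_itvP => //; split.
  + by move=> r; rewrite in_itv /= => /andP[sr _]; apply: cont; exact: le_lt_trans sr.
  (* Derivatives are available for positive times only, so right continuity at 0 comes from the
     Lipschitz bounds. *)
  + have [s1|] := ltP 0 s; first exact/cvg_at_right_filter/cont.
    move=> s1; have -> : s = 0 by apply/eqP; rewrite eq_le s1.
    have cv b : rip (v t) b @[t --> 0^'+] --> rip (v 0) b.
      apply: (@cvg_right _ (norm0 y0 * hnorm b)); first by rewrite mulr_ge0 ?norm0_ge0 ?hnorm_ge0.
      move=> r r0; rewrite -ripNl -ripDl; apply: le_trans (rip_le _ _) _.
      rewrite mulrAC ler_wpM2r ?hnorm_ge0 // hnorm_distC -[X in _ * X]subr0.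
      by apply: wave_velocity_lipschitz => //; exact: ltW.
    have cw b : rip (w t) b @[t --> 0^'+] --> rip (w 0) b.
      apply: (@cvg_right _ (norm0 x0 * hnorm b)); first by rewrite mulr_ge0 ?norm0_ge0 ?hnorm_ge0.
      move=> r r0; rewrite -ripNl -ripDl; apply: le_trans (rip_le _ _) _.
      rewrite mulrAC ler_wpM2r ?hnorm_ge0 // hnorm_distC -[X in _ * X]subr0.
      by apply: wave_lipschitz => //; exact: ltW.
    have cp (q : {poly R}) : q.[t] @[t --> 0^'+] --> q.[0].
      apply: cvg_at_right_filter; have d := dp q 0.
      by apply/differentiable_continuous/derivable1_diffP; exact: ex_derive.
    by apply: cvgB; apply: cvgM => //; apply: cvgD.
  + exact/cvg_at_left_filter/cont/(le_lt_trans s0).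
- by rewrite in_itv /= => rst ?; exists r.
Qed.

End damped_wave_solution.

(** * The lower bound *)

Section cutoff.
Variables (R : realFieldType) (mu : R).

(* (1 - s)^2 (1 + 3 s) at s = mu t: it vanishes to second order at t = 1 / mu
   and agrees with exp(s) to first order at 0. *)
Definition cutoff : {poly R} :=
  1 + mu *: 'X - (5 * mu ^+ 2) *: 'X^2 + (3 * mu ^+ 3) *: 'X^3.

Lemma cutoffE t : cutoff.[t] = 1 + mu * t - 5 * (mu * t) ^+ 2 + 3 * (mu * t) ^+ 3.
Proof. by rewrite /cutoff !hornerE /=; ring. Qed.

Lemma cutoff'E t : cutoff^`().[t] = mu * (1 - 10 * (mu * t) + 9 * (mu * t) ^+ 2).
Proof. by rewrite /cutoff !poly.derivE !hornerE /=; ring. Qed.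

Lemma cutoff''E t : cutoff^`()^`().[t] = mu ^+ 2 * (18 * (mu * t) - 10).
Proof. by rewrite /cutoff !poly.derivE !hornerE /=; ring. Qed.

Hypothesis mu0 : 0 < mu.

(** Everything is a polynomial in [S = mu t], which lies in [[0, 1]]. The middle difference vanishes
    at 0, which produces the factor [t]; its cofactor [(1 - S)(11 - 3 S)] is at most 11. *)
Lemma cutoff_bounds t : 0 <= t <= mu^-1 ->
  [/\ `|cutoff.[t]| <= 4, `|mu * cutoff.[t] - cutoff^`().[t]| <= 11 * mu ^+ 2 * t &
      `|cutoff^`()^`().[t]| <= 10 * mu ^+ 2].
Proof.
move=> /andP[t0 t1].
rewrite cutoffE cutoff'E cutoff''E.
have S0 : 0 <= mu * t by rewrite mulr_ge0 // ltW.
have S1 : mu * t <= 1 by rewrite mulrC -ler_pdivlMr ?div1r.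
have mm : 0 <= mu ^+ 2 by exact: sqr_ge0.
split.
- move: (mu * t) S0 S1 => S S0 S1; rewrite ler_norml; apply/andP; split; nra.
- have -> : mu * (1 + mu * t - 5 * (mu * t) ^+ 2 + 3 * (mu * t) ^+ 3) -
      mu * (1 - 10 * (mu * t) + 9 * (mu * t) ^+ 2) =
      mu ^+ 2 * t * ((1 - mu * t) * (11 - 3 * (mu * t))) by ring.
  have mt0 : 0 <= mu ^+ 2 * t by rewrite mulr_ge0.
  rewrite normrM (ger0_norm mt0) -(mulrA 11) (mulrC 11) ler_wpM2l //.
  move: (mu * t) S0 S1 => S S0 S1; rewrite ler_norml; apply/andP; split; nra.
- rewrite normrM ger0_norm // mulrC ler_wpM2r // ler_norml; apply/andP; split; lra.
Qed.

End cutoff.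

Section lower_bound.
Variables (R : realType) (H H1 : hilbertSpace R) (A sqrtA : operator H).
Variables (B : {linear H -> H}) (iota : H -> H1).
Hypothesis (hA : self_adjoint A) (Apos : positive_operator A).
Hypothesis Bsym : forall u v, rip (B u) v = rip u (B v).
Hypothesis (hS : is_sqrt A sqrtA) (hiota : is_energy_completion A sqrtA iota).
Variables (U : R -> {linear (H1 * H)%type -> (H1 * H)%type}).
Hypothesis (hU : contraction_semigroup U).
Hypothesis hUgen : is_generator (wave_generator sqrtA B iota) U.
Variable (u : R -> H -> H -> H).
Hypothesis hu : is_wave_solution sqrtA iota U u.
Variables (Bh Bmh : {linear H -> H}) (b : R).
Hypothesis b1 : 1 <= b.
Hypothesis Bh_le : forall f, hnorm (Bh f) <= b * hnorm f.
Hypothesis Bmh_le : forall f, hnorm (Bmh f) <= b * hnorm f.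
Hypothesis BhE : forall f, B f = Bh (Bh f).
Hypothesis (BhK : cancel Bh Bmh) (BmhK : cancel Bmh Bh).
Hypothesis Bmhsym : forall f g, rip (Bmh f) g = rip f (Bmh g).
Variables (f : H) (mu : R).
Hypothesis (mu0 : 0 < mu) (mu1 : mu <= 1).
Hypothesis (Ap : dom A (Bmh f)) (ABp : dom A (Bh f)).
Hypothesis fb : b * hnorm f = 2^-1.
Hypothesis feig : hnorm (Bmh (A (Bmh f)) - mu%:C *: f) <= mu ^+ 2 * hnorm f.

Let b0 : 0 < b. Proof. by rewrite (lt_le_trans ltr01). Qed.

(** With these data [Bmh psi1 = - f = - Bh psi], so the two diffusive terms cancel. *)
Let psi : H := Bmh f.
Let psi1 : H := - Bh f.

Let Bpsi : B psi = Bh f. Proof. by rewrite BhE BmhK. Qed.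

(** The normalisation [b |f| = 1/2] bounds both data by 1/2, and [|iota psi|^2] is the form of the
    conjugated operator at [f], at most [(mu + mu^2) |f|^2 <= 1/2]. The squares add up to at most
    1. *)
Lemma energy_norm_le1 : energy_norm iota psi psi1 <= 1.
Proof.
rewrite /energy_norm -[leRHS]sqrtr1 ler_sqrt ?ltr01 //.
have h1 : hnorm psi <= 2^-1 by rewrite -fb; exact: Bmh_le.
have h2 : hnorm psi1 <= 2^-1 by rewrite hnorm_opp -fb; exact: Bh_le.
have f2 : hnorm f <= 2^-1.
  by rewrite -fb ler_peMl // hnorm_ge0.
have h3 : hnorm (iota psi) ^+ 2 <= 2^-1.
  rewrite -ripuu (rip_iotaA hS hiota) //; last exact: (sqrt_dom hS).
  rewrite /psi Bmhsym.
  have := feig; set z := Bmh (A (Bmh f)) => feig'.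
  have -> : rip f z = rip f (z - mu%:C *: f) + mu * rip f f.
    by rewrite !ripE; ring.
  have := le_trans (ler_norm _) (rip_le f (z - mu%:C *: f)).
  have f0 := hnorm_ge0 f.
  have := ler_wpM2l f0 feig'.
  have m2 : mu ^+ 2 <= 1 by rewrite expr_le1 // ltW.
  have ff : hnorm f * hnorm f <= 4^-1 by nra.
  have ff0 : 0 <= hnorm f * hnorm f by rewrite mulr_ge0.
  have := ler_wpM2r ff0 m2; have := ler_wpM2r ff0 mu1.
  rewrite ripuu; move: (rip f _) => ?; lra.
have := hnorm_ge0 psi; have := hnorm_ge0 psi1; nra.
Qed.

(** The mean value theorem is applied on [[0, t0]], where [w] grows at most linearly, and on
    [[t0, 1/mu]], where the assumed decay acts. The total increment is [mu |psi|^2], and dividing by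
    [mu] gives the claim. *)
Lemma wave_lower_bound (t0 del : R) : 1 <= t0 -> t0 < mu^-1 ->
  (forall t, t0 <= t -> t * hnorm (u t psi psi1) <= del) ->
  (4 * b ^+ 4)^-1 <= 7 * mu * (t0 * (1 + t0) ^+ 2) + 14 * del.
Proof.
move=> t01 t0T hdel.
have Spsi1 : dom sqrtA psi1.
  have [h _] := lopZ (sa_lop hA) (- 1) ABp.
  by apply: (sqrt_dom hS); rewrite /psi1 -scaleN1r.
pose w t := u t psi psi1.
have nx1 : norm0 (iota psi, psi1) <= 1.
  apply: le_trans energy_norm_le1; rewrite /norm0 /energy_norm /= ler_sqrt.
    by rewrite -addrA lerDr sqr_ge0.
  by rewrite !addr_ge0 ?sqr_ge0.
have w_le t : 0 <= t -> hnorm (w t) <= 1 + t.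
  move=> tge0.
  have := wave_lipschitz hA Apos hS hiota hU hUgen hu Ap Spsi1 (lexx 0) tge0.
  rewrite -/(w t) -/(w 0) subr0.
  have -> : w 0 = psi := wave_initial hA Apos hS hiota hU hu psi1 Ap.
  have := hnorm_triangle (w t - psi) psi; rewrite subrK.
  have := Bmh_le f; rewrite fb -/psi.
  have := ler_wpM2r tge0 nx1; lra.
pose p := cutoff mu.
pose D r := - rip (w r) (A psi) * p.[r] + rip (w r) (B psi) * p^`().[r] -
      rip (w r) psi * p^`()^`().[r].
have f0 := hnorm_ge0 f.
(* The three terms contribute [4/2], [11 r / 2] and [10/2] times [mu^2 |w r|]; their sum is at most
   [7 (1 + r)] times it. *)
have D_le r : 0 <= r <= mu^-1 -> `|D r| <= 7 * mu ^+ 2 * (hnorm (w r) * (1 + r)).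
  move=> /[dup] rT /andP[r0 _]; have [p0 p1 p2] := cutoff_bounds mu0 rT.
  pose q := Bmh (A (Bmh f)) - mu%:C *: f.
  (* As [B psi = Bh f], [psi] satisfies [A psi = mu B psi] up to the defect [Bh q]. *)
  have Apsi : A psi = Bh q + mu%:C *: Bh f.
    by rewrite /q linearB /= linearZZ BmhK subrK.
  have -> : D r = - (rip (w r) (Bh q) * p.[r] + rip (w r) (Bh f) * (mu * p.[r] - p^`().[r])
      + rip (w r) psi * p^`()^`().[r]).
    by rewrite /D Apsi Bpsi !ripE; ring.
  have bound z c e : hnorm z <= e -> forall k, `|k| <= c ->
      `|rip (w r) z * k| <= hnorm (w r) * (e * c).
    move=> ze k kc; rewrite normrM mulrA ler_pM //.
    by apply: le_trans (rip_le _ _) _; rewrite ler_wpM2l ?hnorm_ge0.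
  have hq : hnorm (Bh q) <= mu ^+ 2 * 2^-1.
    apply: le_trans (Bh_le _) _; rewrite -fb mulrCA ler_pM2l //.
  have hf : hnorm (Bh f) <= 2^-1 by rewrite -fb.
  have hp : hnorm psi <= 2^-1 by rewrite -fb; exact: Bmh_le.
  have e1 := bound _ _ _ hq _ p0; have e2 := bound _ _ _ hf _ p1.
  have e3 := bound _ _ _ hp _ p2.
  rewrite normrN; apply: le_trans (ler_normD _ _) _.
  apply: le_trans (lerD (le_trans (ler_normD _ _) (lerD e1 e2)) e3) _.
  have wm : 0 <= hnorm (w r) * mu ^+ 2 by rewrite mulr_ge0 ?hnorm_ge0 ?sqr_ge0.
  have := mulr_ge0 wm r0; lra.
have MVT := wave_MVT hA Apos Bsym hS hiota hU hUgen hu Ap Spsi1 p Ap.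
have t00 : 0 < t0 by lra.
have [r /andP[r0 rt0]] := MVT 0 t0 (lexx 0) t00.
have [s /andP[ts sT]] := MVT t0 mu^-1 (ltW t00) t0T.
rewrite -/(w _) -/(w _) -/(w _) -/(D s) -/(D r).
have pT : p.[mu^-1] = 0 by rewrite cutoffE divff ?gt_eqF //; ring.
have p'T : p^`().[mu^-1] = 0 by rewrite cutoff'E divff ?gt_eqF //; ring.
have p0 : p.[0] = 1 by rewrite cutoffE; ring.
have p'0 : p^`().[0] = mu by rewrite cutoff'E; ring.
rewrite pT p'T p0 p'0 !mulr0 subrr sub0r.
have -> : u 0 (Bmh f) psi1 = psi := wave_initial hA Apos hS hiota hU hu psi1 Ap.
have -> : (U 0 (iota (Bmh f), psi1)).2 = psi1 := wave_velocity_initial iota hU _ _.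
rewrite -/psi Bpsi {1}/psi1 ripNl (ripC (Bh f)) addNr mul0r sub0r subr0.
(* [G0] is the boundary expression at [t0], which drops out when the two increments are added. *)
move: (_ * _ - _) => G0 e2 e1.
have rT : 0 <= r <= mu^-1 by rewrite (ltW r0) ltW // (lt_trans rt0).
have sT' : 0 <= s <= mu^-1 by rewrite (ltW sT) andbT ltW // (lt_trans t00).
have Dr : `|D r| <= 7 * mu ^+ 2 * (1 + t0) ^+ 2.
  have m7 : 0 <= 7 * mu ^+ 2 by rewrite mulr_ge0 ?sqr_ge0.
  apply: le_trans (D_le r rT) _; apply: (ler_wpM2l m7).
  by have := w_le r (ltW r0); rewrite expr2 => wr; apply: ler_pM; rewrite ?hnorm_ge0; lra.
have Ds : `|D s| <= 14 * mu ^+ 2 * del.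
  apply: le_trans (D_le s sT') _.
  have := hdel s (ltW ts); rewrite -/(w s) => hs.
  (* Since [s >= t0 >= 1], one has [1 + s <= 2 s]. *)
  have h : hnorm (w s) * (1 + s) <= 2 * del.
    have := hnorm_ge0 (w s); nra.
  have := ler_wpM2l (sqr_ge0 mu) h; lra.
have psi_low : (4 * b ^+ 4)^-1 <= rip psi psi.
  have : hnorm f <= b * hnorm psi by rewrite -[X in hnorm X <= _](BmhK f) Bh_le.
  rewrite ripuu -(ler_pM2l b0) fb => h.
  have h2 : 2^-1 ^+ 2 <= (b * (b * hnorm psi)) ^+ 2.
    by rewrite lerXn2r // nnegrE ?mulr_ge0 ?hnorm_ge0 // ltW.
  rewrite -[leLHS]div1r ler_pdivrMr ?mulr_gt0 ?exprn_gt0 //; lra.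
have mT : mu * mu^-1 = 1 by rewrite divff ?gt_eqF.
apply: le_trans psi_low _.
rewrite -(ler_pM2l mu0).
have e3 : mu * rip psi psi = D r * t0 + D s * (mu^-1 - t0).
  by lra.
rewrite e3.
have h1 := ler_wpM2r (ltW t00) (le_trans (ler_norm _) Dr).
have Tt : 0 <= mu^-1 - t0 by rewrite subr_ge0 ltW.
have h2 := ler_wpM2r Tt (le_trans (ler_norm _) Ds).
have d0 : 0 <= del.
  by have := hdel t0 (lexx _); apply: le_trans; rewrite mulr_ge0 ?hnorm_ge0 // ltW.
have h3 : 14 * mu ^+ 2 * del * (mu^-1 - t0) <= 14 * mu * del.
  have -> : 14 * mu ^+ 2 * del * (mu^-1 - t0) =
      14 * mu * del * (mu * mu^-1) - 14 * mu ^+ 2 * del * t0.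
    by ring.
  rewrite mT mulr1 lerBlDr lerDl !mulr_ge0 ?sqr_ge0 // ltW //.
lra.
Qed.

End lower_bound.

(** * Square roots of [B] and approximate eigenvectors near 0 *)

Section square_root.
Variables (R : realType) (H : hilbertSpace R) (A : operator H).
Variables (B Bh Bmh : {linear H -> H}) (c : R).
Hypothesis (hA : self_adjoint A) (Apos : positive_operator A).
Hypothesis (hB : bounded_operator B) (c0 : 0 < c).
Hypothesis Bc : forall u, c * hnorm u ^+ 2 <= rip (B u) u.
Hypothesis hBh : is_sqrt (everywhere B) (everywhere Bh).
Hypothesis (BhK : cancel Bh Bmh) (BmhK : cancel Bmh Bh).
Hypothesis domBmh : forall u, dom A u -> dom A (Bmh u).
Hypothesis domBh : forall u, dom A u -> dom A (Bh u).

Lemma sqrt_opE u : B u = Bh (Bh u).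
Proof. by case: hBh => _ _ _; apply. Qed.

Lemma sqrt_op_sym u v : rip (Bh u) v = rip u (Bh v).
Proof. by case: hBh => sa _ _ _; exact: (sa_sym sa). Qed.

Lemma inv_sqrt_op_sym u v : rip (Bmh u) v = rip u (Bmh v).
Proof. by rewrite -{1}(BmhK v) -sqrt_op_sym BmhK. Qed.

(** From [|Bh u|^2 = rip (B u) u]: boundedness of [B] controls [Bh], and coercivity at [Bmh u]
    controls [Bmh]. The square of [1 + |M| + 1/c] dominates both [M] and [1/c]. *)
Lemma sqrt_op_bounded : exists2 b : R, 1 <= b &
  (forall u, hnorm (Bh u) <= b * hnorm u) /\ (forall u, hnorm (Bmh u) <= b * hnorm u).
Proof.
have [M hM] := hB; exists (1 + `|M| + c^-1).
  by rewrite -addrA lerDl addr_ge0 // invr_ge0 ltW.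
have ci : 0 < c^-1 by rewrite invr_gt0.
have Bhu u : hnorm (Bh u) ^+ 2 = rip (B u) u by rewrite -ripuu -sqrt_op_sym -sqrt_opE.
have M0 := normr_ge0 M; have M1 := ler_norm M.
have bb0 u : 0 <= (1 + `|M| + c^-1) * hnorm u by rewrite mulr_ge0 ?hnorm_ge0 //; lra.
split=> u; have u0 := hnorm_ge0 u.
  rewrite -(ler_pXn2r (ltn0Sn 1)) ?nnegrE ?hnorm_ge0 //.
  rewrite Bhu; apply: le_trans (ler_norm _) _; apply: le_trans (rip_le _ _) _.
  have h1 := ler_wpM2r u0 (hM u); apply: le_trans h1 _.
  rewrite exprMn -mulrA -expr2 ler_wpM2r ?sqr_ge0 //.
  move: `|M| c^-1 ci M0 M1 => *; nra.
rewrite -(ler_pXn2r (ltn0Sn 1)) ?nnegrE ?hnorm_ge0 //.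
have := Bc (Bmh u); rewrite -Bhu BmhK -ler_pdivlMl // => h; apply: le_trans h _.
rewrite exprMn ler_wpM2r ?sqr_ge0 //.
move: `|M| c^-1 ci M0 M1 => *; nra.
Qed.

Let At : operator H := Operator (dom A) (fun u => Bmh (A (Bmh u))).

Lemma conj_op_sym u v : dom A u -> dom A v -> rip (At u) v = rip u (At v).
Proof. by move=> Au Av; rewrite /= inv_sqrt_op_sym (sa_sym hA) ?inv_sqrt_op_sym; auto. Qed.

Lemma conj_op_pos u : dom A u -> u != 0 -> 0 < rip (At u) u.
Proof.
move=> Au u0; rewrite /= inv_sqrt_op_sym; apply: (rip_pos Apos); first exact: domBmh.
by apply: contra_neq u0 => e; rewrite -(BmhK u) e linear0.
Qed.

(** If no interval past [N] carried a vector, [At] would be coercive, and so would [A]: its form at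
    [u] is that of [At] at [Bh u], at least [a |Bh u|^2 >= a c |u|^2]. This contradicts 0 being in
    the spectrum. *)
Lemma conj_op_approx (E : resolution_of_identity H) :
  is_spectral_integral E id At -> spectrum A 0 -> forall N, exists2 k, (N <= k)%N &
  exists f, [/\ f != 0, dom A f &
    hnorm (At f - (k.+1%:R^-1)%:C *: f) <= k.+1%:R^-1 ^+ 2 * hnorm f].
Proof.
move=> hE spec0 N; have Adense : dense (dom At) by case: hA.
apply: contrapT => none.
have [|a a0 coer] := @spectral_coercive R H E At hE conj_op_pos N.
  move=> k f Nk Xf; apply/eqP/negPn/negP => f0; apply: none; exists k => //.
  have k0 : 0 < k.+1%:R :> R by rewrite ltr0n.
  have k2 : 0 < k.+2%:R :> R by rewrite ltr0n.
  exists f; split => //.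
    apply: (spectral_bounded_dom hE (measurable_inv_succ_itv k) (b := k.+1%:R^-1) _ Xf) => x.
    rewrite /inv_succ_itv /= in_itv /= => /andP[x1 x2].
    by rewrite ger0_norm // ltW // (lt_trans _ x1) // invr_gt0.
  apply: (spectral_approx hE conj_op_sym Adense (measurable_inv_succ_itv k) _ Xf).
  move=> x; rewrite /inv_succ_itv /= in_itv /= => /andP[x1 x2]; apply/andP; split; last first.
    by rewrite (le_trans x2) // lerDl sqr_ge0.
  apply: le_trans (ltW x1).
  (* With [mu = 1/(k+1)], the left end [1/(k+2)] exceeds [mu - mu^2] because
     [(mu - mu^2)(1/mu + 1) = 1 - mu^2]. *)
  have kS : k.+2%:R = k.+1%:R + 1 :> R by rewrite natr1.
  rewrite -[leRHS]div1r ler_pdivlMr // kS.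
  have key (m n : R) : m * n = 1 -> (m - m ^+ 2) * (n + 1) <= 1.
    move=> mn; have -> : (m - m ^+ 2) * (n + 1) = m * n - m ^+ 2 + m * (1 - m * n) by ring.
    by rewrite mn; have := sqr_ge0 m; lra.
  by apply: key; rewrite mulVf ?gt_eqF.
apply: spec0; apply: (@sa_coercive_resolvent _ _ _ hA (a * c)); first by rewrite mulr_gt0.
move=> u Au; have := coer _ (domBh Au); rewrite /= inv_sqrt_op_sym !BhK.
have := Bc u; rewrite sqrt_opE sqrt_op_sym ripuu => h1.
by apply: le_trans; rewrite -mulrA ler_pM2l.
Qed.

End square_root.

(** The limit superior is an infimum over neighbourhoods of infinity, so one of them has supremum
    below [del]. Asking for [t0 >= 1] serves the absorption of [1 + t] into [2 t]. *)
Lemma limf_esup_pinfty_le0 (R : realType) (F : R -> \bar R) (del : R) : 0 < del ->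
  (limf_esup F (pinfty_nbhs R) <= 0)%E ->
  exists2 t0 : R, 1 <= t0 & forall t, t0 <= t -> (F t <= del%:E)%E.
Proof.
move=> del0 h.
have /ereal_inf_lt [_ [V [M [_ MV]] <-] hV] :
  (limf_esup F (pinfty_nbhs R) < del%:E)%E by apply: le_lt_trans h _; rewrite lte_fin.
exists (1 + `|M|); first by rewrite lerDl.
move=> t tM; apply: le_trans (ltW hV); apply: ereal_sup_ubound; exists t => //.
by apply: MV; have := ler_norm M; lra.
Qed.

Unset Implicit Arguments.

Theorem proposition5p6 (R : realType) (H : hilbertSpace R)
  (A : operator H) (hA : self_adjoint A) (hA0 : positive_operator A)
  (B : {linear H -> H}) (hB : bounded_operator B)
  (hBs : self_adjoint (everywhere B))
  (c : R) (hc : 0 < c)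
  (hBc : forall u, c%:C * inner H u u <= inner H (B u) u)
  (* B^{1/2} and B^{-1/2} *)
  (Bh Bmh : {linear H -> H})
  (hBh : is_sqrt (everywhere B) (everywhere Bh))
  (hBmh : cancel Bh Bmh /\ cancel Bmh Bh)
  (C : R) (hC : 0 < C)
  (hdom : forall u, dom A u ->
     [/\ dom A (Bh u), dom A (Bmh u),
         hnorm (A (Bh u)) <= C * (hnorm u + hnorm (A u)) &
         hnorm (A (Bmh u)) <= C * (hnorm u + hnorm (A u))])
  (* the operators exp(- t B^{-1/2} A B^{-1/2}) *)
  (expA : R -> {linear H -> H})
  (hexpA : is_exp_semigroup
     (Operator (dom A) (fun u => Bmh (A (Bmh u)))) expA)
  (sqrtA : operator H) (hsqrtA : is_sqrt A sqrtA)
  (H1 : hilbertSpace R) (iota : H -> H1)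
  (hH1 : is_energy_completion A sqrtA iota)
  (U : R -> {linear (H1 * H)%type -> (H1 * H)%type})
  (hU : contraction_semigroup U)
  (hUgen : is_generator (wave_generator sqrtA B iota) U)
  (u : R -> H -> H -> H) (hu : is_wave_solution sqrtA iota U u)
  (h0 : spectrum A 0) :
  (0 < limf_esup (fun t : R =>
     ereal_sup [set (t * hnorm (u t d.1 d.2 - Bmh (expA t (Bh d.1))
                                 - Bmh (expA t (Bmh d.2)))%R)%:E
               | d in [set d : H * H |
                         dom sqrtA d.1 /\ (energy_norm iota d.1 d.2 <= 1)%R]])
     (pinfty_nbhs R))%E.
Proof.
have [BhK BmhK] := hBmh; have [E hE _] := hexpA.
have Bc v : c * hnorm v ^+ 2 <= rip (B v) v.
  have := hBc v; rewrite inner_norm normr_hnorm -rmorphXn -rmorphM lecE => /andP[_].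
  by [].
have dBh v : dom A v -> dom A (Bh v) by case/hdom.
have dBmh v : dom A v -> dom A (Bmh v) by case/hdom.
have Bsym v w : rip (B v) w = rip v (B w) by exact: (sa_sym hBs).
have [b b1 [Bh_le Bmh_le]] := sqrt_op_bounded hB hc Bc hBh BmhK.
have b0 : 0 < b by lra.
rewrite ltNge; apply/negP => hle.
pose kap := (4 * b ^+ 4)^-1.
have kap0 : 0 < kap by rewrite invr_gt0 mulr_gt0 // exprn_gt0.
(* With [del = kap / 28] the term [14 * del] is half of [kap]. *)
have [|t0 t01 ht0] := limf_esup_pinfty_le0 (_ : 0 < kap / 28) hle.
  by rewrite divr_gt0.
(* The other term of the lower bound is [mu * K / 2], less than [kap / 2] once [mu < kap / K]; the
   condition [mu < 1/t0] places [t0] before [1/mu]. *)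
pose K := 14 * (t0 * (1 + t0) ^+ 2).
have K0 : 0 < K by rewrite !mulr_gt0 // ?exprn_gt0; lra.
have [|N hN] := @inv_succ_lt R (Num.min (kap / K) t0^-1).
  by rewrite lt_min divr_gt0 // invr_gt0; lra.
have [k Nk [g [g0 Ag geig]]] := conj_op_approx hA hA0 hc Bc hBh BhK BmhK dBmh dBh hE h0 N.
have := hN k Nk; rewrite lt_min; set mu := k.+1%:R^-1 in geig * => /andP[mu1 mu2].
have mu0 : 0 < mu by rewrite invr_gt0 ltr0n.
have g1 : 0 < hnorm g by rewrite lt0r hnorm_ge0 andbT; apply: contra_neq g0 => /hnorm_eq0.
(* Rescales [g] so that [b |f| = 1/2]. *)
pose q := (2 * b * hnorm g)^-1; have q0 : 0 < q by rewrite invr_gt0 !mulr_gt0.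
pose f := q%:C *: g.
have Af : dom A f by have [] := lopZ (sa_lop hA) q%:C Ag.
have fb : b * hnorm f = 2^-1.
  by rewrite hnorm_scale gtr0_norm // /q; field; rewrite !gt_eqF.
have feig : hnorm (Bmh (A (Bmh f)) - mu%:C *: f) <= mu ^+ 2 * hnorm f.
  have [_ e] := lopZ (sa_lop hA) q%:C (dBmh _ Ag).
  rewrite /f linearZZ e linearZZ scalerA mulrC -scalerA -scalerBr !hnorm_scale.
  by rewrite mulrCA ler_wpM2l.
have t0mu : t0 < mu^-1 by rewrite -[t0]invrK ltf_pV2 ?posrE // invr_gt0; lra.
have mule1 : mu <= 1 by rewrite invf_le1 ?ltr0n // ler1n.
have := wave_lower_bound hA hA0 Bsym hsqrtA hH1 hU hUgen hu b1 Bh_le Bmh_le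
  (sqrt_opE hBh) BmhK (inv_sqrt_op_sym hBh BmhK) mu0 mule1 (dBmh _ Af) (dBh _ Af) fb feig t01 t0mu.
move=> /(_ (kap / 28)); rewrite -/kap.
have decay t : t0 <= t -> t * hnorm (u t (Bmh f) (- Bh f)) <= kap / 28.
  move=> tt; have := ht0 t tt; apply: contraLR; rewrite -!ltNge => hlt.
  apply: lt_le_trans (_ : ((t * hnorm (u t (Bmh f) (- Bh f)))%:E <= _)%E).
    by rewrite lte_fin.
  apply: ereal_sup_ubound; exists (Bmh f, - Bh f) => /=.
    split; first exact/(sqrt_dom hsqrtA)/dBmh.
    exact: (energy_norm_le1 hsqrtA hH1 b1 Bh_le Bmh_le (inv_sqrt_op_sym hBh BmhK)
      mu0 mule1 (dBmh _ Af) fb feig).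
  (* Both exponential terms act on [f], with opposite signs, so only [u t] remains. *)
  by rewrite !linearN /= BhK BmhK opprK subrK.
move=> /(_ decay) h.
have : mu * K < kap by rewrite -ltr_pdivlMr.
rewrite /K; lra.
Qed.
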